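(* Let $R$ be a Dedekind domain whose Picard group has prime order $p$, let $n\ge1$, and let $L$ be a rank-one projective $R$-module that is not free. Then $$\operatorname{fe}_R(R^{n-1}\oplus L)=\sum_{k=1}^n \nu'(n,k,p)\,p^{k-1}.$$
   Context: $\operatorname{Pic}(R)$ is the group of isomorphism classes of rank-one projective $R$-modules under $\otimes_R$; ranks are $\operatorname{rk}(P)=\dim_K(P\otimes_RK)$ with $K$ the fraction field. For a finitely generated projective $R$-module $X$ of rank $n$, $\operatorname{fe}_R(X)$ is the number of feedback classes of regular linear systems over $R$ with state space $X$, which (standing fact) equals the number of $n$-tuples $(Z_1,\dots,Z_n)$ of isomorphism classes of finitely generated projective $R$-modules with $X\cong Z_1\oplus Z_2^{\oplus2}\oplus\cdots\oplus Z_n^{\oplus n}$. For $1\le k\le n$, $\nu(n,k)$ is the number of partitions of $n$ with exactly $k$ distinct part sizes; $\nu(n,k,p)$ is the number of those partitions all of whose distinct part sizes are multiples of $p$; and $\nu'(n,k,p)=\nu(n,k)-\nu(n,k,p)$. *)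

(* Defs.v *)
From HB Require Import structures.
From mathcomp Require Import all_boot all_order all_algebra.
Set Implicit Arguments. Unset Strict Implicit. Unset Printing Implicit Defensive.
Import GRing.Theory.
Local Open Scope ring_scope.

Section Dedekind.
Variable R : idomainType.

Definition is_ideal (I : R -> Prop) : Prop :=
  I 0 /\ (forall x y, I x -> I y -> I (x + y)) /\ (forall a x, I x -> I (a * x)).

Definition fg_ideal (I : R -> Prop) : Prop :=
  exists s : seq R, forall x,
    I x <-> exists c : 'I_(size s) -> R, x = \sum_(i < size s) c i * s`_i.

Definition prime_ideal (I : R -> Prop) : Prop :=
  is_ideal I /\ ~ I 1 /\ (forall x y, I (x * y) -> I x \/ I y).

Definition maximal_ideal (I : R -> Prop) : Prop :=
  is_ideal I /\ ~ I 1 /\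
  (forall J : R -> Prop, is_ideal J -> (forall x, I x -> J x) ->
     J 1 \/ (forall x, J x -> I x)).

Definition noetherian_ring : Prop := forall I, is_ideal I -> fg_ideal I.

Definition integrally_closed : Prop :=
  forall x : {fraction R},
    (exists q : {poly R}, q \is monic /\ root (map_poly (@tofrac R) q) x) ->
    exists r : R, x = tofrac r.

Definition dim_le1 : Prop :=
  forall I, prime_ideal I -> (exists x, I x /\ x <> 0) -> maximal_ideal I.

Definition dedekind_domain : Prop :=
  [/\ noetherian_ring, integrally_closed & dim_le1].

Definition mod_iso (M N : lmodType R) : Prop :=
  exists f : {linear M -> N}, bijective f.

Definition fg_projective (P : lmodType R) : Prop :=
  exists m (f : {linear 'rV[R]_m -> P}) (g : {linear P -> 'rV[R]_m}), cancel g f.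

(* rk P = dim_K (P (x)_R K): P is the image of the idempotent e = g o f on
   R^m, so P (x) K is the image of e over K = Frac R. *)
Definition proj_rank (P : lmodType R) (r : nat) : Prop :=
  exists m (f : {linear 'rV[R]_m -> P}) (g : {linear P -> 'rV[R]_m}),
    cancel g f /\ \rank (map_mx (@tofrac R) (lin1_mx (g \o f))) = r.

Definition num_classes (A : Type) (Pr : A -> Prop) (E : A -> A -> Prop)
  (N : nat) : Prop :=
  exists c : 'I_N -> A,
    (forall i, Pr (c i)) /\ (forall i j, E (c i) (c j) -> i = j) /\
    (forall a, Pr a -> exists i, E a (c i)).

Definition pic_order (N : nat) : Prop :=
  num_classes (fun P : lmodType R => fg_projective P /\ proj_rank P 1)
              mod_iso N.

Fixpoint dpow (Z : lmodType R) (m : nat) : lmodType R :=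
  match m with
  | 0 => 'rV[R]_0
  | m'.+1 => (dpow Z m' * Z)%type
  end.

(* Z_1 (+) Z_2^2 (+) ... (+) Z_k^k, with Z_i := z (i-1) *)
Fixpoint dsum_tuple (z : nat -> lmodType R) (k : nat) : lmodType R :=
  match k with
  | 0 => 'rV[R]_0
  | k'.+1 => (dsum_tuple z k' * dpow (z k') k'.+1)%type
  end.

(* fe_R(X) = N, where n is the rank of X: number of n-tuples of iso classes
   of f.g. projective modules (Z_1..Z_n) with X ~ Z_1 (+) Z_2^2 (+) ... *)
Definition fe_is (X : lmodType R) (n N : nat) : Prop :=
  num_classes
    (fun z : nat -> lmodType R =>
       (forall i, (i < n)%N -> fg_projective (z i)) /\ mod_iso X (dsum_tuple z n))
    (fun z w => forall i, (i < n)%N -> mod_iso (z i) (w i))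
    N.

End Dedekind.

(* A partition of n is encoded by its multiplicity function m, m i = number
   of parts equal to i+1 (i < n). *)
Definition is_partition (n : nat) (m : {ffun 'I_n -> 'I_n.+1}) : bool :=
  (\sum_(i < n) (i.+1 * m i))%N == n.

Definition nu (n k : nat) : nat :=
  #|[pred m : {ffun 'I_n -> 'I_n.+1} |
      is_partition m && (#|[pred i : 'I_n | (m i != 0%N :> nat)]| == k)]|.

Definition nu_p (n k p : nat) : nat :=
  #|[pred m : {ffun 'I_n -> 'I_n.+1} |
      [&& is_partition m, #|[pred i : 'I_n | (m i != 0%N :> nat)]| == k &
          [forall i : 'I_n, (m i != 0%N :> nat) ==> (p %| i.+1)%N]]]|.

Definition nu' (n k p : nat) : nat := (nu n k - nu_p n k p)%N.

(* Main.v *)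
Require Import Defs.
From HB Require Import structures.
From mathcomp Require Import all_boot all_order all_algebra.
From mathcomp Require Import fingroup perm ring.
From Stdlib Require Import Classical ClassicalEpsilon FunctionalExtensionality PropExtensionality.
Set Implicit Arguments. Unset Strict Implicit. Unset Printing Implicit Defensive.
Import GRing.Theory.
Local Open Scope ring_scope.

(** Over a Dedekind domain a finitely generated projective module splits as a
    direct sum of invertible fractional ideals [I_1, ..., I_r], and [A + B] is
    isomorphic to [R + AB]; with the determinant of a change of coordinates,
    this shows that the module is classified by its rank [r] and by the class
    of the product of the [I_i].  Both invariants are additive, so a tuple
    [(Z_1, ..., Z_n)] with [X = Z_1 + Z_2^2 + ... + Z_n^n] amounts to a
    partition of [n] (the ranks [m_i]) and classes [l_i], with [l_i = 0] when
    [m_i = 0], such that the sum of the [i l_i] is the class of [L].  In a group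
    of prime order [p] this equation has [p^(k-1)] solutions on a support of
    size [k] containing an index prime to [p], and none otherwise since the
    class of [L] is not [0]. *)

Local Notation "x %:F" := (tofrac x) : ring_scope.

(** * Fractional ideals *)

Section FractionalIdeals.
Variable R : idomainType.
Local Notation K := {fraction R}.
Implicit Types (I J M P Q : K -> Prop) (x y a b : K) (r : R).

(** [pic_order] supplies only [p] representatives of isomorphism classes, without a group law.
    Tensor products are never formed: fractional ideals are multiplied inside [K], and the product
    is carried over to the [p] indices of the representatives. Modules likewise are handled through
    coordinates in [K], where a change of coordinates is a matrix even though the module need not
    have a basis. The working form of invertibility of [A] is a relation [1 = sum a_i b_i] with
    [a_i] in [A] and [b_i] in its inverse: it splits surjections onto [A], it gives the idempotent
    matrix [(a_i b_j)] that presents [A] as a projective module, and it underlies the choice of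
    comaximal multiples of two ideals. Invertibility of nonzero ideals is where the three Dedekind
    axioms meet: ascending chains drive the induction, dimension one puts products of maximal ideals
    inside a given ideal, and integral closure makes the induction advance. The exponent [k-1]
    arises because the weighted sum, on the [p^k] families supported in a set of size [k] with an
    index prime to [p], has [p] fibres of equal size. *)

Lemma frac_numden x : exists n d : R, d != 0 /\ x = n%:F / d%:F.
Proof.
elim/quotW: x => u; exists (\n_u), (\d_u); have d0 := denom_ratioP u.
split=> //; have dF0 : (\d_u)%:F != 0 :> K by rewrite tofrac_eq0.
apply: (mulIf dF0); rewrite mulfVK //; unlock tofrac; rewrite -[LHS]pi_mul.
apply/eqmodP; rewrite /= equivfE /mulf !numden_Ratio ?mulf_neq0 ?oner_eq0 //.
by rewrite !mulr1 mulrC.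
Qed.

Definition Rset x := exists r, x = r%:F.

Definition submod M :=
  [/\ M 0, forall x y, M x -> M y -> M (x + y) & forall r x, M x -> M (r%:F * x)].

(* Impredicative: the smallest submodule containing all products, so that an
   inclusion of [fmul I J] in a submodule only has to be checked on products. *)
Definition fmul I J x :=
  forall M, submod M -> (forall a b, I a -> J b -> M (a * b)) -> M x.

Definition invI I x := forall y, I y -> Rset (x * y).

(** Only [1] has to be asked for: the product with the colon ideal always lies in [R]
    ([fmul_invI_sub]), so it is then all of [R]. *)
Definition invertible I := submod I /\ fmul I (invI I) 1.

Definition sim I J := exists c : K, c != 0 /\ forall x, I x <-> J (c * x).

Lemma submod0 M : submod M -> M 0. Proof. by case. Qed.
Lemma submodD M x y : submod M -> M x -> M y -> M (x + y).
Proof. by case=> _ + _; apply. Qed.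
Lemma submodZ M r x : submod M -> M x -> M (r%:F * x).
Proof. by case=> _ _; apply. Qed.
Lemma submodN M x : submod M -> M x -> M (- x).
Proof. by move=> sM Mx; rewrite -mulN1r -tofrac1 -tofracN; apply: submodZ. Qed.
Lemma submodB M x y : submod M -> M x -> M y -> M (x - y).
Proof. by move=> sM Mx My; apply: submodD => //; apply: submodN. Qed.
Lemma submodR M x y : submod M -> Rset x -> M y -> M (x * y).
Proof. by move=> sM [r ->]; apply: submodZ. Qed.

Lemma submod_sum M (A : Type) (s : seq A) (F : A -> K) (C : pred A) :
  submod M -> (forall i, C i -> M (F i)) -> M (\sum_(i <- s | C i) F i).
Proof.
move=> sM MF; elim/big_rec: _ => [|i x Ci Mx]; first exact: submod0.
by apply: submodD => //; apply: MF.
Qed.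

Lemma Rset0 : Rset 0. Proof. by exists 0; rewrite tofrac0. Qed.
Lemma Rset1 : Rset 1. Proof. by exists 1; rewrite tofrac1. Qed.
Lemma RsetF r : Rset r%:F. Proof. by exists r. Qed.
Lemma RsetD x y : Rset x -> Rset y -> Rset (x + y).
Proof. by move=> [r ->] [s ->]; exists (r + s); rewrite tofracD. Qed.
Lemma RsetM x y : Rset x -> Rset y -> Rset (x * y).
Proof. by move=> [r ->] [s ->]; exists (r * s); rewrite tofracM. Qed.
Lemma submod_Rset : submod Rset.
Proof. split; [exact: Rset0|exact: RsetD|by move=> r x; apply: RsetM; apply: RsetF]. Qed.
Hint Resolve Rset0 Rset1 RsetF submod_Rset : core.

Lemma submod1_Rset M x : submod M -> M 1 -> Rset x -> M x.
Proof. by move=> sM M1 Rx; rewrite -[x]mulr1; apply: submodR. Qed.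

Lemma submod_fmul I J : submod (fmul I J).
Proof.
split=> [M sM _|x y Ix Iy M sM H|r x Ix M sM H]; first exact: submod0.
  by apply: submodD => //; [apply: Ix|apply: Iy].
by apply: submodZ => //; apply: Ix.
Qed.
Hint Resolve submod_fmul : core.

Lemma mem_fmul I J a b : I a -> J b -> fmul I J (a * b).
Proof. by move=> Ia Jb M _; apply. Qed.

Lemma submod_invI I : submod (invI I).
Proof.
split=> [y _|x x' Ix Ix' y Iy|r x Ix y Iy]; first by rewrite mul0r.
  by rewrite mulrDl; apply: RsetD; [apply: Ix|apply: Ix'].
by rewrite -mulrA; apply: RsetM => //; apply: Ix.
Qed.
Hint Resolve submod_invI : core.

Lemma submod_mulr M c : submod M -> submod (fun x => M (x * c)).
Proof.
move=> sM; split=> [|x y Mx My|r x Mx]; first by rewrite mul0r; apply: submod0.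
  by rewrite mulrDl; apply: submodD.
by rewrite -mulrA; apply: submodZ.
Qed.

Lemma submod_mull M c : submod M -> submod (fun x => M (c * x)).
Proof.
move=> sM; split=> [|x y Mx My|r x Mx]; first by rewrite mulr0; apply: submod0.
  by rewrite mulrDr; apply: submodD.
by rewrite mulrCA; apply: submodZ.
Qed.

(** Lets [fmul_sub] be applied to one factor while another is still universally quantified, as
    nested products require. *)
Lemma submod_forall (A : Type) (D : A -> Prop) (N : A -> K -> Prop) :
  (forall i, D i -> submod (N i)) -> submod (fun x => forall i, D i -> N i x).
Proof.
move=> sN; split=> [i /sN/submod0|x y Nx Ny i Di|r x Nx i Di] //.
  by apply: submodD; [exact: sN|exact: Nx|exact: Ny].
by apply: submodZ; [exact: sN|exact: Nx].
Qed.

Lemma fmul_sub I J M : submod M -> (forall a b, I a -> J b -> M (a * b)) ->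
  forall x, fmul I J x -> M x.
Proof. by move=> sM H x; apply. Qed.

Lemma fmulC I J x : fmul I J x -> fmul J I x.
Proof. by apply: fmul_sub => // a b Ia Jb; rewrite mulrC; apply: mem_fmul. Qed.

Lemma fmulS I I' J J' : (forall x, I x -> I' x) -> (forall x, J x -> J' x) ->
  forall x, fmul I J x -> fmul I' J' x.
Proof.
by move=> sI sJ; apply: fmul_sub => // a b /sI Ia /sJ Jb; apply: mem_fmul.
Qed.

Lemma fmulA I J Q x : fmul (fmul I J) Q x -> fmul I (fmul J Q) x.
Proof.
apply: fmul_sub => // a b Ha; move: b; move: a Ha; apply: fmul_sub.
  by apply: submod_forall => b _; apply: submod_mulr.
by move=> a b Ia Jb c Qc; rewrite -mulrA; do 2 apply: mem_fmul => //.
Qed.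

Lemma fmulAr I J Q x : fmul I (fmul J Q) x -> fmul (fmul I J) Q x.
Proof.
move=> /fmulC H; apply: fmulC; apply: (fmulS (I := Q) (J := fmul J I)) => //.
  by move=> y /fmulC.
by apply: fmulA; move: H; apply: fmulS => // y /fmulC.
Qed.

Lemma fmul1 I x : submod I -> fmul Rset I x -> I x.
Proof. by move=> sI; apply: fmul_sub => // a b Ra Ib; apply: submodR. Qed.

Lemma fmul1r I x : I x -> fmul Rset I x.
Proof. by move=> Ix; rewrite -[x]mul1r; apply: mem_fmul. Qed.

(** The finite sums of products form a submodule, scalars being absorbed into the first factor.
    Applied to [1] in [I I^-1], this yields a dual basis of [I]. *)
Lemma fmul_seq I J x : submod I -> fmul I J x ->
  exists s : seq (K * K), (forall u, u \in s -> I u.1 /\ J u.2) /\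
    x = \sum_(u <- s) u.1 * u.2.
Proof.
move=> sI; move: x; apply: fmul_sub => [|a b Ia Jb]; last first.
  by exists [:: (a, b)]; split=> [u|]; rewrite ?big_seq1 // inE => /eqP ->.
split; first by exists [::]; rewrite big_nil.
  move=> x1 x2 [s1 [H1 ->]] [s2 [H2 ->]]; exists (s1 ++ s2); rewrite big_cat.
  by split=> // u; rewrite mem_cat => /orP[/H1|/H2].
move=> r y [s [H ->]]; exists [seq (r%:F * u.1, u.2) | u <- s].
split=> [u /mapP[v /H[H1 H2] ->] /=|]; first by split=> //; apply: submodZ.
by rewrite big_map mulr_sumr; apply: eq_bigr => u _; rewrite mulrA.
Qed.

Lemma invertible_neq0 I : invertible I -> exists2 a, I a & a != 0.
Proof.
move=> [sI I1]; apply: NNPP => H; have I0 a : I a -> a = 0.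
  by move=> Ia; apply/eqP/negPn/negP=> a0; case: H; exists a.
suff: 1 = 0 :> K by move/eqP; rewrite oner_eq0.
apply: (@fmul_sub I (invI I) (fun x => x = 0) _ _ 1 I1) => [|a b /I0 -> _]; last by rewrite mul0r.
by split=> [//|x y -> ->|r x ->]; rewrite ?addr0 ?mulr0.
Qed.

Lemma fmul_invI_sub I x : fmul I (invI I) x -> Rset x.
Proof. by apply: fmul_sub => // a b Ia; rewrite mulrC; apply. Qed.

(** Write [1 = 1 * 1] with one factor in [I I^-1] and the other in [J J^-1]; each term [(ab)(cd)]
    regroups as [(ac)(bd)], and [bd] carries [IJ] into [R]. *)
Lemma invertible_fmul I J : invertible I -> invertible J -> invertible (fmul I J).
Proof.
move=> [sI I1] [sJ J1]; split=> //.
have H a b c d : I a -> invI I b -> J c -> invI J d ->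
    fmul (fmul I J) (invI (fmul I J)) ((a * b) * (c * d)).
  move=> Ia Ib Jc Jd; rewrite mulrACA; apply: mem_fmul; first exact: mem_fmul.
  apply: fmul_sub => [|a' c' Ia' Jc']; first exact: submod_mull.
  by rewrite mulrACA; apply: RsetM; [apply: Ib|apply: Jd].
suff H1 u : fmul I (invI I) u -> forall v, fmul J (invI J) v ->
    fmul (fmul I J) (invI (fmul I J)) (u * v) by rewrite -[1]mulr1; apply: H1.
move: u.
apply: fmul_sub => [|a b Ia Ib].
  by apply: submod_forall => v _; apply: submod_mulr.
by apply: fmul_sub => [|c d]; [exact: submod_mull|exact: H].
Qed.

Lemma invertible_invI I : invertible I -> invertible (invI I).
Proof.
move=> [sI I1]; split=> //; apply: fmulC; move: I1; apply: fmulS => // x Ix y.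
by rewrite mulrC; apply.
Qed.

Lemma invertible_Rset : invertible Rset.
Proof.
by split=> //; rewrite -[1]mulr1; apply: mem_fmul => // y; rewrite mul1r.
Qed.

Lemma sim_refl I : sim I I.
Proof. by exists 1; rewrite oner_eq0; split=> // x; rewrite mul1r. Qed.
Lemma sim_ext I J : (forall x, I x <-> J x) -> sim I J.
Proof. by move=> E; exists 1; rewrite oner_eq0; split=> // x; rewrite mul1r. Qed.
Lemma sim_sym I J : sim I J -> sim J I.
Proof.
move=> [c [c0 H]]; exists c^-1; rewrite invr_eq0; split=> // x.
by rewrite -[x in J x](mulVKf c0) -H.
Qed.
Lemma sim_trans J I Q : sim I J -> sim J Q -> sim I Q.
Proof.
move=> [c [c0 H]] [d [d0 H']]; exists (d * c); rewrite mulf_neq0 //; split=> // x.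
by rewrite H H' mulrA.
Qed.

Lemma sim_fmul I I' J J' : sim I I' -> sim J J' -> sim (fmul I J) (fmul I' J').
Proof.
have half I1 I2 J1 J2 c d : (forall x, I1 x -> I2 (c * x)) ->
    (forall x, J1 x -> J2 (d * x)) -> forall x, fmul I1 J1 x -> fmul I2 J2 (x * (c * d)).
  move=> H H' ; apply: fmul_sub => [|a b /H Ia /H' Jb]; first exact: submod_mulr.
  have -> : a * b * (c * d) = (c * a) * (d * b) by ring.
  exact: mem_fmul.
move=> [c [c0 H]] [d [d0 H']]; exists (c * d); rewrite mulf_neq0 //; split=> // x.
rewrite [c * d * x]mulrC; split; first by apply: half => y; rewrite ?H ?H'.
move/(@half _ I _ J c^-1 d^-1).
rewrite -invfM mulfK ?mulf_neq0 //; apply=> y; rewrite ?H ?H' mulVKf //.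
Qed.

End FractionalIdeals.
#[local] Hint Resolve Rset0 Rset1 RsetF submod_Rset submod_fmul submod_invI sim_refl : core.

(** * Invertibility of ideals in a Dedekind domain *)

Section Dedekind.
Variable R : idomainType.
Hypothesis dedR : dedekind_domain R.
Local Notation K := {fraction R}.
Implicit Types (I J M P Q : K -> Prop) (x y a b : K) (r : R).

(** Integral ideals are kept inside [K] so as to share products and inverses with fractional ideals;
    [idealK_of] returns to ideals of [R]. *)
Definition idealK I := submod I /\ forall x, I x -> Rset x.

Lemma idealK_of I : idealK I -> is_ideal (fun r => I r%:F).
Proof.
move=> [sI _]; split; first by rewrite tofrac0; apply: submod0.
split=> [r s|r s] Ir; first by rewrite tofracD; apply: submodD.
by rewrite tofracM; apply: submodZ.
Qed.

Lemma idealK_fg I : idealK I -> exists s : seq K,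
  forall x, I x <-> exists c : 'I_(size s) -> R, x = \sum_(i < size s) (c i)%:F * s`_i.
Proof.
move=> iI; have [noeth _ _] := dedR.
have [s Hs] := noeth _ (idealK_of iI); exists [seq r%:F | r <- s] => x.
rewrite size_map.
have E (c : 'I_(size s) -> R) : \sum_(i < size s) (c i)%:F * [seq r%:F | r <- s]`_i
    = (\sum_(i < size s) c i * s`_i)%:F :> K.
  rewrite rmorph_sum; apply: eq_bigr => i _.
  by rewrite (nth_map 0) // rmorphM.
split=> [Ix|[c ->]]; last by rewrite E; apply/Hs; exists c.
have [_ /(_ x Ix) [r rE]] := iI; move: Ix; rewrite rE => /Hs [c ->].
by exists c; rewrite E.
Qed.

(** The step may assume [C] for all strictly larger ideals. A counterexample would give, by choice,
    a strictly ascending chain of counterexamples; the union is finitely generated, so it equals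
    some stage, which contradicts strictness. *)
Lemma noetherian_ind (C : (K -> Prop) -> Prop) :
  (forall I, idealK I ->
    (forall J, idealK J -> (forall x, I x -> J x) -> ~ (forall x, J x -> I x) -> C J) ->
    C I) ->
  forall I, idealK I -> C I.
Proof.
move=> step I0 iI0; apply: NNPP => nC0.
pose T := {I | idealK I /\ ~ C I}.
have next (I : T) : exists J : T, (forall x, sval I x -> sval J x) /\
    ~ (forall x, sval J x -> sval I x).
  case: I => I [iI nCI] /=; apply: NNPP => H; apply: nCI; apply: step => // J iJ IJ nJI.
  by apply: NNPP => nCJ; apply: H; exists (exist _ J (conj iJ nCJ)).
have [f Hf] := choice _ next.
pose u n : T := iter n f (exist _ I0 (conj iI0 nC0)).
have uS n x : sval (u n) x -> sval (u n.+1) x by case: (Hf (u n)) => + _; apply.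
have uD m n x : (m <= n)%N -> sval (u m) x -> sval (u n) x.
  by move=> /subnKC <-; elim: (n - m)%N => [|k IH]; rewrite ?addn0 // addnS => /IH /uS.
have iu n : idealK (sval (u n)) by case: (svalP (u n)).
pose U x := exists n, sval (u n) x.
have iU : idealK U.
  split; last by move=> x [n]; case: (iu n) => _; apply.
  split; first by exists 0%N; apply: submod0; case: (iu 0%N).
    move=> x y [m xm] [n yn]; exists (maxn m n).
    have [sM _] := iu (maxn m n).
    by apply: submodD => //; [apply: uD xm; apply: leq_maxl|apply: uD yn; apply: leq_maxr].
  by move=> r x [n xn]; exists n; apply: submodZ => //; case: (iu n).
have [s Hs] := idealK_fg iU.
(* The generators of the union are caught one at a time, the stage being raised to a maximum at
   each. *)
have gens k : (k <= size s)%N -> exists n, forall i, (i < k)%N -> sval (u n) s`_i.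
  elim: k => [|k IH] ks; first by exists 0%N.
  have [n Hn] := IH (ltnW ks).
  have [m Hm] : U s`_k.
    apply/Hs; exists (fun i => (i == Ordinal ks)%:R).
    rewrite (bigD1 (Ordinal ks)) //= eqxx tofrac1 mul1r big1 ?addr0 // => i /negPf ->.
    by rewrite tofrac0 mul0r.
  exists (maxn m n) => i; rewrite ltnS leq_eqVlt => /orP[/eqP ->|/Hn Hi].
    by apply: uD Hm; apply: leq_maxl.
  by apply: uD Hi; apply: leq_maxr.
have [n Hn] := gens _ (leqnn _); have [_] := Hf (u n); apply=> x fx.
have /Hs [c ->] : U x by exists n.+1.
have [sM _] := iu n.
by apply: submod_sum => // i _; apply: submodZ => //; apply: Hn.
Qed.

(** * Maximal ideals and their products *)

Definition maxI P :=
  [/\ idealK P, ~ P 1 & forall J, idealK J -> (forall x, P x -> J x) ->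
     J 1 \/ (forall x, J x -> P x)].

Definition fadd I J x := exists a b, [/\ I a, J b & x = a + b].

Lemma fadd_ideal I J : idealK I -> idealK J -> idealK (fadd I J).
Proof.
move=> [sI RI] [sJ RJ]; split; last first.
  by move=> x [a [b [/RI Ra /RJ Rb ->]]]; apply: RsetD.
split; first by exists 0, 0; split; rewrite ?addr0 //; apply: submod0.
  move=> x y [a [b [Ia Jb ->]]] [a' [b' [Ia' Jb' ->]]]; exists (a + a'), (b + b').
  by split; [exact: submodD|exact: submodD|rewrite addrACA].
move=> r x [a [b [Ia Jb ->]]]; exists (r%:F * a), (r%:F * b).
by split; [exact: submodZ|exact: submodZ|rewrite mulrDr].
Qed.

Definition genI a x := exists r, x = r%:F * a.

Lemma genI_ideal a : Rset a -> idealK (genI a).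
Proof.
move=> Ra; split; last by move=> x [r ->]; apply: RsetM.
split; first by exists 0; rewrite tofrac0 mul0r.
  by move=> x y [r ->] [s ->]; exists (r + s); rewrite tofracD mulrDl.
by move=> r x [s ->]; exists (r * s); rewrite tofracM mulrA.
Qed.

Lemma genI_id a : genI a a. Proof. by exists 1; rewrite tofrac1 mul1r. Qed.

Lemma faddl I J x : submod J -> I x -> fadd I J x.
Proof. by move=> sJ Ix; exists x, 0; rewrite addr0; split=> //; apply: submod0. Qed.
Lemma faddr I J x : submod I -> J x -> fadd I J x.
Proof. by move=> sI Jx; exists 0, x; rewrite add0r; split=> //; apply: submod0. Qed.

(** Noetherian induction takes the place of Zorn's lemma: a proper ideal that is not maximal lies in
    a strictly larger proper one. *)
Lemma maxI_exists I : idealK I -> ~ I 1 -> exists2 P, maxI P & forall x, I x -> P x.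
Proof.
move: I; apply: noetherian_ind => I iI IH nI1.
case: (classic (maxI I)) => [mI|nmI]; first by exists I.
have [J [iJ IJ nJ1 nJI]] : exists J, [/\ idealK J, forall x, I x -> J x, ~ J 1 &
    ~ (forall x, J x -> I x)].
  apply: NNPP => H; apply: nmI; split=> // J iJ IJ.
  case: (classic (J 1)) => [|nJ1]; [by left|right].
  by apply: NNPP => nJI; apply: H; exists J.
by have [P mP JP] := IH J iJ IJ nJI nJ1; exists P => // x /IJ /JP.
Qed.

Lemma maxI_prime P x y : maxI P -> Rset x -> Rset y -> P (x * y) -> P x \/ P y.
Proof.
move=> [iP nP1 mP] Rx Ry Pxy; case: (classic (P x)) => [|nPx]; [by left|right].
have [sP _] := iP; have iG := genI_ideal Rx.
case: (mP (fadd P (genI x))).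
- exact: fadd_ideal.
- by move=> z; apply: faddl; case: iG.
- move=> [p [_ [Pp [r ->] E]]]; rewrite -[y]mul1r E mulrDl.
  apply: submodD => //; first by rewrite mulrC; apply: submodR.
  by rewrite -mulrA; apply: submodZ.
- by move=> H; case: nPx; apply: H; apply: faddr => //; apply: genI_id.
Qed.

Lemma maxI_sub_eq P Q : maxI P -> maxI Q -> (forall x, P x -> Q x) ->
  forall x, Q x -> P x.
Proof. by move=> [_ _ mP] [iQ nQ1 _] PQ; case: (mP Q iQ PQ). Qed.

Definition prodI (s : seq (K -> Prop)) := foldr (@fmul R) (@Rset R) s.

Lemma fmul_ideal I J : idealK I -> idealK J -> idealK (fmul I J).
Proof.
move=> [sI RI] [sJ RJ]; split=> //.
by apply: fmul_sub => // a b /RI Ra /RJ Rb; apply: RsetM.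
Qed.

Fixpoint allmax (s : seq (K -> Prop)) :=
  if s is P :: s' then maxI P /\ allmax s' else True.

Lemma prodI_ideal s : allmax s -> idealK (prodI s).
Proof.
elim: s => [_|P s IH [[iP _ _] /IH is_]]; last exact: fmul_ideal.
by split.
Qed.

Lemma allmax_cat s t : allmax s -> allmax t -> allmax (s ++ t).
Proof. by elim: s => //= P s IH [mP ms] mt; split=> //; apply: IH. Qed.

Lemma prodI_cat s t x : prodI (s ++ t) x -> fmul (prodI s) (prodI t) x.
Proof.
elim: s x => [|P s IH] x /=; first exact: fmul1r.
by move=> H; apply: fmulAr; move: H; apply: fmulS.
Qed.

(** If [xy] is in [I] but neither [x] nor [y] is, then [(I + x)(I + y)] lies in [I], and the lists
    found for the two larger ideals are concatenated. *)
Lemma prod_max_sub I : idealK I -> (exists2 a, I a & a != 0) ->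
  exists2 s, allmax s & forall x, prodI s x -> I x.
Proof.
move: I; apply: noetherian_ind => I iI IH [a Ia a0]; have [sI RI] := iI.
case: (classic (I 1)) => [I1|nI1]; first by exists [::] => // x; apply: submod1_Rset.
case: (classic (exists x y, [/\ Rset x, Rset y, I (x * y), ~ I x & ~ I y])).
  move=> [x [y [Rx Ry Ixy nIx nIy]]].
  have big z : Rset z -> ~ I z -> exists2 s, allmax s & forall w, prodI s w -> fadd I (genI z) w.
    move=> Rz nIz; have iG := genI_ideal Rz; apply: IH; first exact: fadd_ideal.
    - by move=> w; apply: faddl; case: iG.
    - by move=> H; apply: nIz; apply: H; apply: faddr => //; apply: genI_id.
    - by exists a => //; apply: faddl => //; case: iG.
  have [s ms Hs] := big x Rx nIx; have [t mt Ht] := big y Ry nIy.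
  exists (s ++ t); first exact: allmax_cat.
  move=> w /prodI_cat; move: w; apply: fmul_sub => // u v /Hs [c [_ [Ic [r ->] ->]]].
  move=> /Ht [d [_ [Id [r' ->] ->]]].
  rewrite mulrDl; apply: submodD => //.
    rewrite mulrC; apply: submodR => //; apply: RsetD; first exact: RI.
    by apply: RsetM.
  rewrite mulrDr; apply: submodD => //; first by apply: submodR => //; apply: RsetM.
  by rewrite mulrACA -tofracM; apply: submodZ.
(* Without such a pair [I] is prime and nonzero, hence maximal by dimension one, and the list
   [[:: I]] serves. *)
move=> nxy; have pI : prime_ideal (fun r => I r%:F).
  split; first exact: idealK_of.
  split=> [|r s]; first by rewrite tofrac1.
  rewrite tofracM => Irs; apply: NNPP => /not_or_and [nr ns].
  by apply: nxy; exists r%:F, s%:F; split.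
have [_ _ d1] := dedR; have [r aE] := RI _ Ia.
have [_ [_ mI]] : maximal_ideal (fun r => I r%:F).
  apply: d1 => //; exists r; rewrite -aE; split=> // r0.
  by rewrite aE r0 tofrac0 eqxx in a0.
exists [:: I]; last by move=> x /fmulC; apply: fmul1.
split=> //; split=> // J iJ IJ; have [_ RJ] := iJ.
case: (mI (fun r => J r%:F)) => [||J1|JI]; first exact: idealK_of.
- by move=> s; apply: IJ.
- by left; rewrite -tofrac1.
- by right=> x Jx; have [s sE] := RJ _ Jx; move: Jx; rewrite sE; apply: JI.
Qed.

Lemma fmul_sub_max I J P : idealK I -> idealK J -> maxI P ->
  (forall x, fmul I J x -> P x) -> (forall x, I x -> P x) \/ (forall x, J x -> P x).
Proof.
move=> [_ RI] [_ RJ] mP H; case: (classic (forall x, I x -> P x)) => [|nI]; [by left|right].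
move=> y Jy; apply: NNPP => nPy; apply: nI => x Ix.
have := maxI_prime mP (RI _ Ix) (RJ _ Jy) (H _ (mem_fmul Ix Jy)).
by case.
Qed.

(** [P] is prime, so it contains one of the factors, and equals it by maximality; that factor is
    moved to the front by commutativity. *)
Lemma prod_sub_max s P : allmax s -> maxI P -> (forall x, prodI s x -> P x) ->
  exists s', [/\ allmax s', size s = (size s').+1 &
    forall x, fmul P (prodI s') x -> prodI s x].
Proof.
move=> + mP; elim: s => [_ H|Q s IH /= [mQ ms] H].
  by have [_ + _] := mP; case; apply: H; apply: Rset1.
have [iQ _ _] := mQ.
case: (fmul_sub_max iQ (prodI_ideal ms) mP H) => [QP|/(IH ms) [s' [ms' ss' Hs']]].
  exists s; split=> // x; apply: fmulS => //.
  exact: maxI_sub_eq.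
exists (Q :: s'); split; rewrite //= ?ss' // => x /fmulAr H1.
apply: (fmulS (I := Q) (J := fmul P (prodI s'))) => //.
by apply: fmulA; move: H1; apply: fmulS => // y /fmulC.
Qed.

(** Take a shortest product of maximal ideals inside [(a)]. It lies in [P], so [P] is one factor;
    the product of the others has an element [b] outside [(a)], and [b / a] is the witness. The
    induction on a bound for the length stands for the minimal choice. *)
Lemma max_inv_notin P : maxI P -> (exists2 a, P a & a != 0) ->
  exists2 x, invI P x & ~ Rset x.
Proof.
move=> mP [a Pa a0]; have [[sP RP] _ _] := mP; have Ra := RP _ Pa.
have iG := genI_ideal Ra.
have [|s ms Hs] := prod_max_sub iG; first by exists a => //; apply: genI_id.
move: {2}(size s) (leqnn (size s)) => n; elim: n s ms Hs => [|n IH] s ms Hs sn.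
  have [|s' [_]] := prod_sub_max ms mP; last by move: sn; rewrite leqn0 => /eqP ->.
  by move=> x /Hs [r ->]; apply: submodZ.
have [|s' [ms' ss' Hs']] := prod_sub_max ms mP.
  by move=> x /Hs [r ->]; apply: submodZ.
case: (classic (forall x, prodI s' x -> genI a x)) => [H|nH].
  by apply: (IH s') => //; move: sn; rewrite ss' ltnS.
have [b sb nab] : exists2 b, prodI s' b & ~ genI a b.
  by apply: NNPP => H; apply: nH => x sx; apply: NNPP => nx; apply: H; exists x.
exists (b / a).
  move=> y Py; have /Hs' /Hs [r E] := mem_fmul Py sb.
  by exists r; rewrite mulrAC [b * y]mulrC E mulfK.
by move=> [r E]; apply: nab; exists r; rewrite -E mulfVK.
Qed.

(* Cayley-Hamilton: multiplication by [x] on the generators is a matrix over [R]. *)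
Lemma integral_stable I x : idealK I -> (exists2 a, I a & a != 0) ->
  (forall y, I y -> I (x * y)) -> Rset x.
Proof.
move=> iI [a Ia a0] xI; have [_ intc _] := dedR.
have [s Hs] := idealK_fg iI.
have Is (i : 'I_(size s)) : I s`_i.
  apply/Hs; exists (fun j => (j == i)%:R).
  rewrite (bigD1 i) //= eqxx tofrac1 mul1r big1 ?addr0 // => j /negPf ->.
  by rewrite tofrac0 mul0r.
have [A HA] := choice _ (fun i => proj1 (Hs _) (xI _ (Is i))).
pose B : 'M[R]_(size s) := \matrix_(i, j) A j i.
apply: intc; exists (char_poly B); split; first exact: char_poly_monic.
rewrite map_char_poly -eigenvalue_root_char; apply/eigenvalueP.
exists (\row_i s`_i).
  apply/rowP=> i; rewrite !mxE HA; apply: eq_bigr => j _.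
  by rewrite !mxE mulrC.
apply/eqP => v0; move/Hs: Ia a0 => [c ->]; rewrite big1 ?eqxx // => i _.
by move/rowP/(_ i): v0; rewrite !mxE => ->; rewrite mulr0.
Qed.

(** Choose a maximal [P] containing [I] and [x] in [P^-1] outside [R]. Then [J = P^-1 I] is an ideal
    of [R] strictly larger than [I], since otherwise [x I] would lie in [I] and [x] would be
    integral. By induction [J] is invertible, and [J^-1 P^-1] lies in [I^-1]. *)
Lemma ideal_invertible I : idealK I -> (exists2 a, I a & a != 0) -> invertible I.
Proof.
move: I; apply: noetherian_ind => I iI IH [a Ia a0]; have [sI RI] := iI; split=> //.
case: (classic (I 1)) => [I1|nI1].
  by rewrite -[1]mulr1; apply: mem_fmul => // y; rewrite mul1r; apply: RI.
have [P mP IP] := maxI_exists iI nI1.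
have [x Px nRx] : exists2 x, invI P x & ~ Rset x.
  by apply: max_inv_notin => //; exists a => //; apply: IP.
have [[_ RP] _ _] := mP.
have P1 : invI P 1 by move=> y; rewrite mul1r; apply: RP.
have IJ y : I y -> fmul (invI P) I y by move=> Iy; rewrite -[y]mul1r; apply: mem_fmul.
have [] : invertible (fmul (invI P) I).
  apply: IH => //.
  - by split=> //; apply: fmul_sub => // u v Pu Iv; apply: Pu; apply: IP.
  - move=> H; apply: nRx; apply: (integral_stable iI); first by exists a.
    by move=> y Iy; apply: H; apply: mem_fmul.
  - by exists a => //; apply: IJ.
move=> _ /fmulC /fmulAr /fmulC; apply: fmulS => // y.
apply: fmul_sub => // c d cJ Pd z Iz; rewrite -mulrA; apply: cJ.
exact: mem_fmul.
Qed.

(** * Avoiding finitely many maximal ideals, and comaximal multiples *)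

Fixpoint avoids (A : K -> Prop) al (s : seq (K -> Prop)) :=
  if s is P :: s' then ~ (forall y, A y -> P (al * y)) /\ avoids A al s' else True.

(** A maximal ideal containing the product of the list is a member of the list. *)
Lemma avoids_not_sub A al s P : allmax s -> maxI P -> (forall x, prodI s x -> P x) ->
  avoids A al s -> ~ (forall y, A y -> P (al * y)).
Proof.
move=> + mP; elim: s => [_ H|Q s IH /= [mQ ms] H [nQ av]].
  by have [_ + _] := mP; case; apply: H; apply: Rset1.
have [iQ _ _] := mQ.
case: (fmul_sub_max iQ (prodI_ideal ms) mP H) => [QP|sP]; last exact: IH.
by move=> alP; apply: nQ => y /alP; apply: maxI_sub_eq.
Qed.

Lemma avoids_add A al be s : allmax s -> (forall y, A y -> prodI s (be * y)) ->
  avoids A al s -> avoids A (al + be) s.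
Proof.
elim: s => //= Q s IH [mQ ms] H [nQ av]; have [[sQ RQ] _ _] := mQ.
have [sP RP] := prodI_ideal ms; split; last first.
  by apply: IH => // y /H; apply: fmul_sub => // u v /RQ; apply: submodR.
move=> alQ; apply: nQ => y Ay.
rewrite -[al](addrK be) mulrBl; apply: submodB => //; first exact: alQ.
by move: (H y Ay); apply: fmul_sub => // u v Qu /RP Rv; rewrite mulrC; apply: submodR.
Qed.

(** If [al], good for [s], fails at the new [P], it is corrected by some [be] with [be A] inside the
    product of [s] but not inside [P]: the old conditions survive because [be A] lies in every
    member of [s]. *)
Lemma invertible_avoid A s : invertible A -> allmax s ->
  exists2 al, invI A al & avoids A al s.
Proof.
move=> iA; elim: s => [_|P s IH /= [mP ms]]; first by exists 0 => //; apply: submod0.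
have [al Aal av] := IH ms; have [[sP _] _ _] := mP; have [sS RS] := prodI_ideal ms.
case: (classic (forall y, A y -> P (al * y))) => [alP|]; last by exists al.
(* If no such [be] existed, [A A^-1] times the product of [s], which contains that product, would
   lie in [P]. Then [P] would be a member of [s], where [al] is already good. *)
have [be Abe beP] : exists2 be, fmul (invI A) (prodI s) be &
    ~ (forall y, A y -> P (be * y)).
  apply: NNPP => H; apply: (avoids_not_sub ms mP _ av) => // x sx.
  have [_ A1] := iA; rewrite -[x]mul1r.
  apply: (@fmul_sub _ A (invI A) (fun u => P (u * x)) _ _ 1 A1) => [|a b Aa Ab].
    exact: submod_mulr.
  apply: NNPP => nP; apply: H; exists (b * x); first exact: mem_fmul.
  by move=> /(_ _ Aa); rewrite mulrC mulrA.
exists (al + be).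
  apply: (@submodD _ (invI A)) => //; move: (be) Abe; apply: fmul_sub => // u v Au /RS Rv.
  by rewrite mulrC; apply: (@submodR _ (invI A)).
have H y : A y -> prodI s (be * y).
  move=> Ay; move: be Abe {beP}; apply: fmul_sub => [|u v Au sv]; first exact: submod_mulr.
  by rewrite mulrAC; apply: submodR => //; apply: Au.
split; last exact: avoids_add.
move=> abP; apply: beP => y Ay; rewrite -[be](addKr al) mulrDl.
by apply: submodD; rewrite ?mulNr //; [apply: submodN => //; apply: alP|apply: abP].
Qed.

Definition scaleI c I x := exists2 y, I y & x = c * y.

Lemma scaleI_ideal c I : submod I -> invI I c -> idealK (scaleI c I).
Proof.
move=> sI Ic; split; last by move=> x [y Iy ->]; apply: Ic.
split; first by exists 0; rewrite ?mulr0 //; apply: submod0.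
  by move=> x y [u Iu ->] [v Iv ->]; exists (u + v); rewrite ?mulrDr //; apply: submodD.
by move=> r x [u Iu ->]; exists (r%:F * u); rewrite 1?mulrCA //; apply: submodZ.
Qed.

(** Any nonzero [be] in [B^-1] will do. The ideal [be B] contains a product of maximal ideals, and
    [al] is chosen to avoid those. A maximal ideal containing [al A + be B] would contain this
    product, hence be one of the avoided ideals. *)
Lemma invertible_comaximal A B : invertible A -> invertible B ->
  exists al be a b, [/\ invI A al, invI B be, A a, B b & al * a + be * b = 1].
Proof.
move=> iA iB; have [be Bbe be0] := invertible_neq0 (invertible_invI iB).
have [sA _] := iA; have [sB _] := iB.
have [b Bb b0] := invertible_neq0 iB.
have iJ := scaleI_ideal sB Bbe.
have [|s ms Hs] := prod_max_sub iJ.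
  by exists (be * b); rewrite ?mulf_neq0 //; exists b.
have [al Aal av] := invertible_avoid iA ms.
have iI := scaleI_ideal sA Aal.
case: (classic (fadd (scaleI al A) (scaleI be B) 1)).
  by move=> [_ [_ [[a Aa ->] [b' Bb' ->] E]]]; exists al, be, a, b'.
move=> n1; have [P mP NP] := maxI_exists (fadd_ideal iI iJ) n1.
case: (avoids_not_sub ms mP _ av).
  by move=> x /Hs Jx; apply: NP; apply: faddr => //; case: iI.
by move=> y Ay; apply: NP; apply: faddl; [case: iJ|exists y].
Qed.

End Dedekind.

(** * Direct sums of fractional ideals *)

Section Coordinates.
Variable R : idomainType.
Local Notation K := {fraction R}.
Implicit Types (M : K -> Prop) (I J : nat -> K -> Prop) (P Q : lmodType R).

Lemma pred_ext (A B : K -> Prop) : (forall x, A x <-> B x) -> A = B.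
Proof.
by move=> AB; apply: functional_extensionality => x; apply: propositional_extensionality.
Qed.

(** All [r] factors are taken at once, rather than by iterating [fmul], because the terms of a
    determinant permute the factors; [iprodS] recovers the iterated form. *)
Definition iprod (r : nat) I (x : K) :=
  forall M, submod M ->
    (forall v : nat -> K, (forall i, (i < r)%N -> I i (v i)) -> M (\prod_(i < r) v i)) ->
    M x.

Lemma submod_iprod r I : submod (iprod r I).
Proof.
split=> [M sM _|x y Ix Iy M sM H|a x Ix M sM H]; first exact: submod0.
  by apply: submodD => //; [apply: Ix|apply: Iy].
by apply: submodZ => //; apply: Ix.
Qed.
Hint Resolve submod_iprod : core.

Lemma iprod_sub r I M : submod M ->
  (forall v : nat -> K, (forall i, (i < r)%N -> I i (v i)) -> M (\prod_(i < r) v i)) ->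
  forall x, iprod r I x -> M x.
Proof. by move=> sM H x; apply. Qed.

Lemma mem_iprod r I (v : nat -> K) : (forall i, (i < r)%N -> I i (v i)) ->
  iprod r I (\prod_(i < r) v i).
Proof. by move=> Iv M sM; apply. Qed.

Lemma mem_iprod_ord r I (v : 'I_r -> K) : (forall i : 'I_r, I i (v i)) ->
  iprod r I (\prod_i v i).
Proof.
move=> Iv; pose w i := if insub i is Some j then v j else 0.
have wE (i : 'I_r) : w i = v i by rewrite /w valK.
rewrite (eq_bigr (fun i : 'I_r => w i)) => [|i _]; last by rewrite wE.
apply: mem_iprod => i ir.
rewrite -[i]/(val (Ordinal ir)) wE; exact: Iv.
Qed.

Lemma iprod_ext r I J : (forall i, (i < r)%N -> I i = J i) -> iprod r I = iprod r J.
Proof.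
by move=> E; apply: pred_ext => x; split=> H M sM HM; apply: H => // v Hv;
  apply: HM => i ir; [rewrite -E|rewrite E] => //; apply: Hv.
Qed.

Lemma iprod0 I : iprod 0 I = @Rset R.
Proof.
apply: pred_ext => x; split; first by apply: iprod_sub => // v _; rewrite big_ord0.
move=> Rx M sM H; apply: submod1_Rset => //.
by have := H (fun _ => 0); rewrite big_ord0; apply.
Qed.

Lemma iprodS r I : iprod r.+1 I = fmul (iprod r I) (I r).
Proof.
apply: pred_ext => x; split.
  apply: iprod_sub => // v Hv; rewrite big_ord_recr; apply: mem_fmul; last exact: Hv.
  by apply: mem_iprod => i ir; apply: Hv; apply: ltnW.
apply: fmul_sub => // a b + Ib; move: a; apply: iprod_sub => [|v Hv].
  exact: submod_mulr.
have -> : (\prod_(i < r) v i) * b = \prod_(i < r.+1) (if (i < r)%N then v i else b).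
  rewrite big_ord_recr /= ltnn; congr (_ * _).
  by apply: eq_bigr => i _; rewrite ltn_ord.
apply: (mem_iprod (v := fun i => if (i < r)%N then v i else b)) => i.
rewrite ltnS leq_eqVlt => /orP[/eqP ->|ir]; first by rewrite ltnn.
by rewrite ir; apply: Hv.
Qed.

Lemma fmulRset M : submod M -> fmul M (@Rset R) = M.
Proof.
move=> sM; apply: pred_ext => x; split; first by move/fmulC; apply: fmul1.
by move/fmul1r/fmulC.
Qed.

Lemma iprod1 I : submod (I 0%N) -> iprod 1 I = I 0%N.
Proof.
move=> sI; rewrite iprodS iprod0; apply: pred_ext => x.
by split; [apply: fmul1|apply: fmul1r].
Qed.

Definition catf (T : Type) r (f g : nat -> T) i := if (i < r)%N then f i else g (i - r)%N.

Lemma catf_l (T : Type) r (f g : nat -> T) i : (i < r)%N -> catf r f g i = f i.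
Proof. by rewrite /catf => ->. Qed.
Lemma catf_r (T : Type) r (f g : nat -> T) i : catf r f g (r + i)%N = g i.
Proof. by rewrite /catf ltnNge leq_addr addKn. Qed.

Lemma iprod_cat r s I J :
  iprod (r + s) (catf r I J) = fmul (iprod r I) (iprod s J).
Proof.
elim: s => [|s IH].
  rewrite addn0 iprod0 fmulRset //; apply: iprod_ext => i; exact: catf_l.
rewrite addnS !iprodS IH catf_r; apply: pred_ext => x.
by split; [apply: fmulA|apply: fmulAr].
Qed.

Lemma invertible_iprod r I : (forall i, (i < r)%N -> invertible (I i)) ->
  invertible (iprod r I).
Proof.
elim: r => [|r IH] iI; first by rewrite iprod0; apply: invertible_Rset.
rewrite iprodS; apply: invertible_fmul; last exact: iI.
by apply: IH => i ir; apply: iI; apply: ltnW.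
Qed.

Lemma iprod_Rset r : iprod r (fun _ => @Rset R) = @Rset R.
Proof. by elim: r => [|r IH]; rewrite ?iprod0 // iprodS IH fmulRset. Qed.

(** * Coordinates of a module in fractional ideals *)

Definition semilin P (phi : P -> K) :=
  (forall x y, phi (x + y) = phi x + phi y) /\
  (forall (a : R) x, phi (a *: x) = a%:F * phi x).

Section Semilin.
Variables (P : lmodType R) (phi : P -> K).
Hypothesis lphi : semilin phi.
Lemma semilinD x y : phi (x + y) = phi x + phi y. Proof. by case: lphi. Qed.
Lemma semilinZ a x : phi (a *: x) = a%:F * phi x. Proof. by case: lphi. Qed.
Lemma semilin0 : phi 0 = 0.
Proof. by rewrite -(scale0r 0) semilinZ tofrac0 mul0r. Qed.
Lemma semilinN x : phi (- x) = - phi x.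
Proof. by rewrite -scaleN1r semilinZ tofracN tofrac1 mulN1r. Qed.
Lemma semilinB x y : phi (x - y) = phi x - phi y.
Proof. by rewrite semilinD semilinN. Qed.
Lemma semilin_sum (A : Type) (s : seq A) (F : A -> P) :
  phi (\sum_(i <- s) F i) = \sum_(i <- s) phi (F i).
Proof.
by elim: s => [|i s IH]; rewrite ?big_nil ?semilin0 // !big_cons semilinD IH.
Qed.
End Semilin.

(* [phi] identifies the submodule [S] of [P] with the direct sum of the
   fractional ideals [I i], [i < r]. *)
Definition repS P (S : P -> Prop) (r : nat) (phi : nat -> P -> K) I :=
  [/\ forall i, semilin (phi i),
      forall i, (i < r)%N -> invertible (I i),
      forall i x, (i < r)%N -> S x -> I i (phi i x),
      forall x, S x -> (forall i, (i < r)%N -> phi i x = 0) -> x = 0 &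
      forall v : nat -> K, (forall i, (i < r)%N -> I i (v i)) ->
        exists2 x, S x & forall i, (i < r)%N -> phi i x = v i].

Definition rep P := repS (fun _ : P => True).

Lemma rep_ext P r phi I J : (forall i, (i < r)%N -> I i = J i) ->
  rep (P := P) r phi I -> rep r phi J.
Proof.
move=> E [H1 H2 H3 H4 H5]; split=> // [i ir|i x ir|v Hv]; rewrite -?E //; auto.
by apply: H5 => i ir; rewrite E //; apply: Hv.
Qed.

Lemma rep_inj P r phi I x y : rep (P := P) r phi I ->
  (forall i, (i < r)%N -> phi i x = phi i y) -> x = y.
Proof.
move=> [lphi _ _ inj _] E; apply/eqP; rewrite -subr_eq0; apply/eqP; apply: inj => // i ir.
by rewrite semilinB // E // subrr.
Qed.

Lemma rep_prod P Q r s phi psi I J : rep (P := P) r phi I -> rep (P := Q) s psi J ->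
  rep (P := (P * Q)%type) (r + s)
    (catf r (fun i x => phi i x.1) (fun i x => psi i x.2)) (catf r I J).
Proof.
move=> [l1 v1 m1 i1 s1] [l2 v2 m2 i2 s2].
have split_ord i : (i < r + s)%N -> (i < r)%N \/ exists2 j, (j < s)%N & i = (r + j)%N.
  move=> irs; case: (ltnP i r) => ir; [by left|right].
  by exists (i - r)%N; rewrite ?subnKC // -(ltn_add2l r) subnKC.
split.
- move=> i; rewrite /catf; case: ifP => _; split=> *; rewrite ?semilinD ?semilinZ //.
- by move=> i /split_ord[ir|[j js ->]]; [rewrite catf_l //|rewrite catf_r]; auto.
- by move=> i x /split_ord[ir|[j js ->]] _; [rewrite !catf_l //|rewrite !catf_r]; auto.
- move=> [x y] _ H; congr (_, _); [apply: i1 => // i ir|apply: i2 => // i ir].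
    by have := H i (ltn_addr _ ir); rewrite catf_l.
  by have := H (r + i)%N; rewrite ltn_add2l catf_r; apply.
- move=> v Hv; have [|x _ Hx] := s1 v.
    by move=> i ir; have := Hv i (ltn_addr _ ir); rewrite catf_l.
  have [|y _ Hy] := s2 (fun i => v (r + i)%N).
    by move=> i ir; have := Hv (r + i)%N; rewrite ltn_add2l catf_r; apply.
  by exists (x, y) => // i /split_ord[ir|[j js ->]]; [rewrite catf_l //|rewrite catf_r]; auto.
Qed.

Definition rVcoord m i (x : 'rV[R]_m) : K :=
  if insub i is Some j then (x 0 j)%:F else 0.

Lemma rVcoordE m (j : 'I_m) (x : 'rV[R]_m) : rVcoord j x = (x 0 j)%:F.
Proof. by rewrite /rVcoord valK. Qed.

Lemma rVcoord_semilin m i : semilin (@rVcoord m i).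
Proof.
rewrite /rVcoord; case: insub => [j|]; split=> *; rewrite ?addr0 ?mulr0 ?mxE //.
  by rewrite tofracD.
by rewrite tofracM.
Qed.

Lemma rep_rV m : rep (P := 'rV[R]_m) m (@rVcoord m) (fun _ => @Rset R).
Proof.
split=> //.
- exact: rVcoord_semilin.
- by move=> i _; apply: invertible_Rset.
- by move=> i x im _; rewrite -[i]/(val (Ordinal im)) rVcoordE.
- move=> x _ H; apply/rowP=> j; apply/eqP; rewrite mxE -tofrac_eq0 -rVcoordE.
  by rewrite H.
- move=> v Hv; have [f Hf] := choice _ (fun i : 'I_m => Hv i (ltn_ord i)).
  exists (\row_i f i) => // i im.
  by rewrite -[i]/(val (Ordinal im)) rVcoordE mxE -Hf.
Qed.

Lemma mk_linear P Q (f : P -> Q) : (forall a x y, f (a *: x + y) = a *: f x + f y) ->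
  exists g : {linear P -> Q}, g =1 f.
Proof.
move=> lf; pose m := GRing.isLinear.Build R P Q _ f lf.
by exists (HB.pack f m : {linear P -> Q}).
Qed.

Lemma rep_transition P Q r phi psi I : rep (P := P) r phi I -> rep (P := Q) r psi I ->
  exists f : P -> Q, forall x i, (i < r)%N -> psi i (f x) = phi i x.
Proof.
move=> [_ _ m1 _ _] [_ _ _ _ s2].
apply: (choice (fun x y => forall i, (i < r)%N -> psi i y = phi i x)) => x.
by have [y _ Hy] := s2 (phi^~ x) (fun i ir => m1 i x ir Logic.I); exists y.
Qed.

Lemma rep_mod_iso P Q r phi psi I : rep (P := P) r phi I -> rep (P := Q) r psi I ->
  mod_iso P Q.
Proof.
move=> rP rQ; have [f Hf] := rep_transition rP rQ; have [g Hg] := rep_transition rQ rP.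
have [l1 _ _ _ _] := rP; have [l2 _ _ _ _] := rQ.
have [h hE] : exists h : {linear P -> Q}, h =1 f.
  apply: mk_linear => a x y; apply: (rep_inj rQ) => i ir.
  by rewrite Hf // !semilinD // !semilinZ // !Hf.
exists h, g => x; rewrite ?hE; [apply: (rep_inj rP)|apply: (rep_inj rQ)] => i ir.
  by rewrite Hg // Hf.
by rewrite Hf // Hg.
Qed.

Lemma mod_iso_rep P Q r phi I : mod_iso P Q -> rep (P := P) r phi I ->
  exists psi, rep (P := Q) r psi I.
Proof.
move=> [f [g fK gK]] [l1 v1 m1 i1 s1]; exists (fun i x => phi i (g x)).
have gD x y : g (x + y) = g x + g y.
  by apply: (can_inj fK); rewrite linearD !gK.
have gZ a x : g (a *: x) = a *: g x by apply: (can_inj fK); rewrite linearZ !gK.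
split=> // [i|i x ir _|x _ H|v /s1 [x _ Hx]].
- by split=> *; rewrite ?gD ?gZ ?semilinD ?semilinZ.
- exact: m1.
- by rewrite -[x]gK (i1 (g x)) ?linear0.
- by exists (f x) => // i ir; rewrite fK Hx.
Qed.

(** * Changes of coordinates, their matrices and determinants *)

Lemma common_denom r (v : nat -> K) :
  exists2 c : R, c != 0 & forall i, (i < r)%N -> Rset (c%:F * v i).
Proof.
elim: r => [|r [c c0 Hc]]; first by exists 1; rewrite ?oner_eq0.
have [n [d [d0 E]]] := frac_numden (v r).
exists (c * d); first by rewrite mulf_neq0.
move=> i; rewrite ltnS leq_eqVlt tofracM => /orP[/eqP ->|/Hc H].
  rewrite E -mulrA [X in _ * X]mulrCA divff ?tofrac_eq0 // mulr1 -tofracM; exact: RsetF.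
by rewrite mulrAC mulrC; apply: RsetM.
Qed.

Lemma rep_unit P r phi I i y : rep (P := P) r phi I -> (i < r)%N -> I i y ->
  exists x, forall k, (k < r)%N -> phi k x = if k == i then y else 0.
Proof.
move=> [l v m inj s] ir Iy; have [|x _ Hx] := s (fun k => if k == i then y else 0).
  move=> k kr; case: eqP => [->//|_]; by apply: submod0; case: (v k kr).
by exists x.
Qed.

(** In place of a basis, take [x_i] in [P] whose only nonzero coordinate is some [d_i] in [I i]; the
    coefficients are [psi x_i / d_i]. A common denominator [c] makes [c *: x] an [R]-combination of
    the [x_i]. *)
Lemma rep_functional P r phi I psi : rep (P := P) r phi I -> semilin psi ->
  exists a : nat -> K, forall x, psi x = \sum_(i < r) phi i x * a i.
Proof.
move=> rP lpsi; have [l v m inj s] := rP.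
have ex i : exists u : K * P, (i < r)%N ->
    u.1 != 0 /\ forall k, (k < r)%N -> phi k u.2 = if k == i then u.1 else 0.
  case: (ltnP i r) => ir; last by exists (0, 0).
  have [d Id d0] := invertible_neq0 (v i ir); have [x Hx] := rep_unit rP ir Id.
  by exists (d, x).
have [u Hu] := choice _ ex; exists (fun i => psi (u i).2 / (u i).1) => x.
have [c c0 Hc] := common_denom r (fun i => phi i x / (u i).1).
have [rho Hrho] : exists rho : 'I_r -> R, forall i : 'I_r, c%:F * (phi i x / (u i).1) = (rho i)%:F.
  by apply: (choice (fun (i : 'I_r) y => c%:F * (phi i x / (u i).1) = y%:F)) => i; apply: Hc.
have E : c *: x = \sum_(i < r) rho i *: (u i).2.
  apply: (rep_inj rP) => k kr; rewrite semilinZ // semilin_sum //.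
  rewrite (bigD1 (Ordinal kr)) //= big1 ?addr0 => [|i ik].
    have [u0 uE] := Hu k kr; rewrite semilinZ // uE // eqxx -Hrho /=.
    by rewrite -mulrA divfK.
  have [u0 uE] := Hu i (ltn_ord i); rewrite semilinZ // uE //.
  by rewrite eq_sym (negPf (_ : (i : nat) != k)) ?mulr0 //.
have cF0 : c%:F != 0 :> K by rewrite tofrac_eq0.
apply: (mulfI cF0); rewrite -semilinZ // E semilin_sum // mulr_sumr.
apply: eq_bigr => i _; rewrite semilinZ // -Hrho; ring.
Qed.

Lemma rep_functional_uniq P r phi I (a : nat -> K) : rep (P := P) r phi I ->
  (forall x, \sum_(i < r) phi i x * a i = 0) -> forall i, (i < r)%N -> a i = 0.
Proof.
move=> rP H i ir; have [l v m inj s] := rP.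
have [d Id d0] := invertible_neq0 (v i ir); have [x Hx] := rep_unit rP ir Id.
have := H x; rewrite (bigD1 (Ordinal ir)) //= big1 ?addr0.
  by rewrite Hx // eqxx => /eqP; rewrite mulf_eq0 (negPf d0) => /eqP.
by move=> k ki; rewrite Hx // (negPf (_ : (k : nat) != i)) ?mul0r.
Qed.

Lemma rep_functional_mem P r phi I M psi (a : nat -> K) : rep (P := P) r phi I ->
  (forall x, psi x = \sum_(i < r) phi i x * a i) -> (forall x, M (psi x)) ->
  forall i y, (i < r)%N -> I i y -> M (y * a i).
Proof.
move=> rP E Mpsi i y ir Iy; have [x Hx] := rep_unit rP ir Iy.
have := Mpsi x; rewrite E (bigD1 (Ordinal ir)) //= big1 ?addr0.
  by rewrite Hx // eqxx.
by move=> k ki; rewrite Hx // (negPf (_ : (k : nat) != i)) ?mul0r.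
Qed.

Lemma rep_matrix P r phi I (psi : nat -> P -> K) :
  rep r phi I -> (forall j, semilin (psi j)) ->
  exists A : nat -> nat -> K, forall j x, psi j x = \sum_(i < r) phi i x * A i j.
Proof.
move=> rP lpsi; have [A HA] := choice _ (fun j => rep_functional rP (lpsi j)).
by exists (fun i j => A j i).
Qed.

Definition mxn r s (A : nat -> nat -> K) : 'M[K]_(r, s) := \matrix_(i, j) A i j.

(** Substituting one system into the other writes [phi k] in terms of the [phi i], and such
    coefficients are unique. The [psi j] need not be coordinates of a decomposition, which
    [proj_rank_rep] relies on. *)
Lemma rep_mulmx1 P r s phi I (psi : nat -> P -> K) (A B : nat -> nat -> K) : rep r phi I ->
  (forall j x, psi j x = \sum_(i < r) phi i x * A i j) ->
  (forall i x, phi i x = \sum_(j < s) psi j x * B j i) ->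
  mxn r s A *m mxn s r B = 1%:M.
Proof.
move=> rP HA HB; apply/matrixP => i k; rewrite !mxE.
apply/eqP; rewrite -subr_eq0; apply/eqP.
pose a i' := (\sum_(j < s) A i' j * B j k) - (i' == k)%:R.
have a0 : forall i', (i' < r)%N -> a i' = 0.
  apply: (rep_functional_uniq rP) => x.
  rewrite (eq_bigr (fun i' : 'I_r => \sum_(j < s) phi i' x * A i' j * B j k -
     (if i' == k then phi k x else 0))); last first.
    move=> i' _; rewrite /a mulrBr mulr_sumr; congr (_ - _).
      by apply: eq_bigr => j _; rewrite mulrA.
    by rewrite -val_eqE /=; case: eqP => [->|_]; rewrite ?mulr1 ?mulr0.
  rewrite sumrB -big_mkcond /= big_pred1_eq exchange_big /= [phi k x]HB.
  apply/eqP; rewrite subr_eq0; apply/eqP; apply: eq_bigr => j _.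
  by rewrite -mulr_suml -HA.
have := a0 i (ltn_ord i); rewrite /a => {2}<-; congr (_ - _).
by apply: eq_bigr => j _; rewrite !mxE.
Qed.

(* Each term of the Leibniz expansion maps the product of the [I i] into that
   of the [J j]. *)
Lemma det_iprod r I J (A : nat -> nat -> K) :
  (forall i j y, (i < r)%N -> (j < r)%N -> I i y -> J j (y * A i j)) ->
  forall x, iprod r I x -> iprod r J (x * \det (mxn r r A)).
Proof.
move=> HA; apply: iprod_sub => [|v Hv]; first exact: submod_mulr.
rewrite mulr_sumr; apply: submod_sum => // s _.
rewrite mulrCA; apply: (@submodR _ (iprod r J)) => //.
  by exists ((-1) ^+ s); rewrite rmorphXn rmorphN rmorph1.
rewrite -big_split /= (reindex_perm s^-1%g) /=; apply: mem_iprod_ord => j.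
by rewrite mxE permKV; apply: HA => //; apply: Hv.
Qed.

(** The transition matrices are mutually inverse over [K], which forces [r = s]. Their determinants
    map the two products into each other and are inverse scalars, so the determinant is the
    homothety sought. *)
Lemma rep_uniq P r s phi psi I J : rep (P := P) r phi I -> rep (P := P) s psi J ->
  r = s /\ sim (iprod r I) (iprod s J).
Proof.
move=> r1 r2; have [l1 _ m1 _ _] := r1; have [l2 _ m2 _ _] := r2.
have [A HA] := rep_matrix r1 l2; have [B HB] := rep_matrix r2 l1.
have AB := rep_mulmx1 r1 HA HB; have BA := rep_mulmx1 r2 HB HA.
have rs : r = s by apply/eqP; rewrite eqn_leq (mulmx1_min AB) (mulmx1_min BA).
split=> //; subst s.
have dAB : \det (mxn r r A) * \det (mxn r r B) = 1 by rewrite -det_mulmx AB det1.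
have dA0 : \det (mxn r r A) != 0.
  by apply/eqP=> d0; move/eqP: dAB; rewrite d0 mul0r eq_sym oner_eq0.
exists (\det (mxn r r A)); split=> // x; rewrite mulrC; split.
  apply: det_iprod => i j y ir jr.
  exact: (rep_functional_mem (M := J j) (a := A^~ j) r1 (HA j) (fun x => m2 j x jr Logic.I)).
move/(@det_iprod r J I B); rewrite -mulrA dAB mulr1; apply=> i j y ir jr.
exact: (rep_functional_mem (M := I j) (a := B^~ j) r2 (HB j) (fun x => m1 j x jr Logic.I)).
Qed.

End Coordinates.
#[local] Hint Resolve submod_iprod : core.

(** * Projective modules *)

Section FixedModule.
Variables (R : idomainType) (m : nat) (e : 'M[R]_m).

(** For idempotent [e] the fixed row vectors are exactly the image of [e], and multiplication by [e]
    retracts the free module onto them. *)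
Definition fix_pred : {pred 'rV[R]_m} := fun v => v *m e == v.

Lemma fix_pred_closed : submod_closed fix_pred.
Proof.
split=> [|a x y]; rewrite !unfold_in ?mul0mx // => /eqP Ex /eqP Ey.
by rewrite mulmxDl -scalemxAl Ex Ey.
Qed.
HB.instance Definition _ := GRing.isSubmodClosed.Build R _ fix_pred fix_pred_closed.

Record fix_mod := FixMod { fix_val : 'rV[R]_m; _ : fix_val \in fix_pred }.
HB.instance Definition _ := [isSub for fix_val].
HB.instance Definition _ := [Choice of fix_mod by <:].
HB.instance Definition _ := [SubChoice_isSubLmodule of fix_mod by <:].

Lemma fix_mod_projective : e *m e = e -> fg_projective fix_mod.
Proof.
move=> ee; have fP v : v *m e \in fix_pred by rewrite unfold_in -mulmxA ee.
have [|f fE] := @mk_linear R 'rV[R]_m fix_mod (fun v => FixMod (fP v)).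
  by move=> a x y; apply: val_inj; rewrite /= mulmxDl scalemxAl.
have [|g gE] := @mk_linear R fix_mod 'rV[R]_m fix_val; first by [].
exists m, f, g => x; apply: val_inj; rewrite /= fE gE /=.
by case: x => v /= /eqP.
Qed.
End FixedModule.

Section Projective.
Variable R : idomainType.
Local Notation K := {fraction R}.
Implicit Types (M : K -> Prop) (I J : nat -> K -> Prop) (P Q : lmodType R).

(** From [1 = sum a_i b_i] the matrix [e = (a_i b_j)] has entries in [R] and is idempotent. Its
    fixed vectors are the rows [(b_j y)] with [y] in [A], and [y] is recovered as [sum x_i a_i]. *)
Lemma invertible_module (A : K -> Prop) : invertible A ->
  exists P : lmodType R, fg_projective P /\ exists phi, rep (P := P) 1 phi (fun _ => A).
Proof.
move=> iA; have [sA A1] := iA; have [s [Hs s1]] := fmul_seq sA A1.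
pose m := size s; pose u (i : 'I_m) := nth (0, 0) s i.
have Au i : A (u i).1 by case: (Hs (u i)) => //; apply: mem_nth.
have Bu i : invI A (u i).2 by case: (Hs (u i)) => //; apply: mem_nth.
have u1 : \sum_i (u i).1 * (u i).2 = 1 by rewrite s1 (big_nth (0, 0)) big_mkord.
have [c Hc] : exists c : 'I_m * 'I_m -> R, forall ij, (u ij.2).2 * (u ij.1).1 = (c ij)%:F.
  apply: (choice (fun (ij : 'I_m * 'I_m) y => (u ij.2).2 * (u ij.1).1 = y%:F)) => ij.
  by apply: Bu; apply: Au.
pose e : 'M[R]_m := \matrix_(i, j) c (i, j).
have eE i j : (e i j)%:F = (u i).1 * (u j).2 by rewrite mxE -Hc mulrC.
have ee : e *m e = e.
  apply/matrixP => i k; apply/eqP; rewrite -tofrac_eq mxE rmorph_sum /=.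
  rewrite (eq_bigr (fun j => (u i).1 * (u k).2 * ((u j).1 * (u j).2))) => [|j _].
    by rewrite -mulr_sumr u1 mulr1 eE.
  by rewrite rmorphM /= !eE; ring.
exists (fix_mod e : lmodType R); split; first exact: fix_mod_projective.
pose phi (x : fix_mod e) : K := \sum_i (fix_val x 0 i)%:F * (u i).1.
have phiE x j : (fix_val x 0 j)%:F = phi x * (u j).2.
  case: x => v /= vP; move: (vP); rewrite /phi /= => /eqP {1}<-.
  rewrite mxE rmorph_sum mulr_suml; apply: eq_bigr => i _.
  by rewrite rmorphM /= eE mulrA.
exists (fun _ => phi); split=> //.
- move=> _; split=> [x y|a x]; rewrite /phi ?mulr_sumr -?big_split; apply: eq_bigr => i _.
    by rewrite /= mxE rmorphD mulrDl.
  by rewrite /= mxE rmorphM mulrA.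
- move=> _ x _ _; apply: submod_sum => // i _; exact: submodZ.
- move=> x _ /(_ 0%N isT) x0; apply: val_inj; apply/rowP=> j; apply/eqP.
  by rewrite -tofrac_eq /= phiE x0 mul0r mxE rmorph0.
move=> v /(_ 0%N isT) Av0.
have [t Ht] : exists t : 'I_m -> R, forall i, (u i).2 * v 0%N = (t i)%:F.
  by apply: (choice (fun i y => (u i).2 * v 0%N = y%:F)) => i; apply: Bu.
have tP : \row_i t i \in fix_pred e.
  apply/eqP/rowP=> j; apply/eqP; rewrite -tofrac_eq !mxE rmorph_sum -Ht /=.
  rewrite (eq_bigr (fun i => (u j).2 * v 0%N * ((u i).1 * (u i).2))) => [|i _].
    by rewrite -mulr_sumr u1 mulr1.
  by rewrite rmorphM /= eE mxE -Ht; ring.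
exists (FixMod tP) => // -[|//] _; rewrite /phi /=.
rewrite (eq_bigr (fun i => v 0%N * ((u i).1 * (u i).2))) => [|i _].
  by rewrite -mulr_sumr u1 mulr1.
by rewrite mxE -Ht; ring.
Qed.

(** The defining idempotent factors over [K] as [B A] with [A B = 1] of size [r]; the factorization
    bounds its rank above by [r], and [1 = A (B A) B] bounds it below. *)
Lemma proj_rank_rep P k r phi I : proj_rank P k -> rep (P := P) r phi I -> k = r.
Proof.
move=> [m [f [g [gK rk]]]] rP; have [lphi _ _ _ _] := rP.
pose psi j x := rVcoord j (g x).
have lpsi j : semilin (psi j).
  have [lD lZ] := @rVcoord_semilin R m j.
  by split=> *; rewrite /psi ?linearD ?linearZ ?lD ?lZ.
have [A HA] := rep_matrix rP lpsi.
pose B i j := if insub i is Some i' then phi j (f 'e_(i' : 'I_m)) else 0 : K.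
have BE (i : 'I_m) j : B i j = phi j (f 'e_i) by rewrite /B valK.
have HB j x : phi j x = \sum_(i < m) psi i x * B i j.
  rewrite -[x in LHS]gK [g x in LHS]row_sum_delta linear_sum semilin_sum //.
  by apply: eq_bigr => i _; rewrite linearZ semilinZ // BE /psi rVcoordE.
have AB := rep_mulmx1 rP HA HB.
have E : map_mx (@tofrac R) (lin1_mx (g \o f)) = mxn m r B *m mxn r m A.
  apply/matrixP=> i j; rewrite !mxE /=.
  rewrite -rVcoordE -[LHS]/(psi j (f 'e_i)) HA; apply: eq_bigr => l _.
  by rewrite !mxE BE.
rewrite -rk E; apply/eqP; rewrite eqn_leq.
rewrite (leq_trans (mxrankM_maxr _ _) (rank_leq_row _)) /=.
rewrite -{1}(mxrank1 K r) -[1%:M]mulmx1 -{2}AB -{1}AB mulmxA.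
rewrite -[mxn r m A *m _ *m _]mulmxA.
by apply: leq_trans (mxrankM_maxl _ _) (mxrankM_maxr _ _).
Qed.

Lemma fg_projective_prod P Q : fg_projective P -> fg_projective Q ->
  fg_projective (P * Q)%type.
Proof.
move=> [m [f [g gK]]] [n [f' [g' gK']]].
have [|F FE] := @mk_linear R 'rV[R]_(m + n) (P * Q)%type
    (fun v => (f (lsubmx v), f' (rsubmx v))).
  by move=> a x y; rewrite !linearP.
have [|G GE] := @mk_linear R (P * Q)%type 'rV[R]_(m + n)
    (fun u => row_mx (g u.1) (g' u.2)).
  by move=> a x y; rewrite /= !linearP scale_row_mx add_row_mx.
by exists (m + n)%N, F, G => -[x y]; rewrite FE GE /= row_mxKl row_mxKr gK gK'.
Qed.

Lemma fg_projective_rV n : fg_projective 'rV[R]_n.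
Proof. by exists n, idfun, idfun. Qed.

End Projective.

(** * Steinitz normal form *)

Section Steinitz.
Variable R : idomainType.
Hypothesis dedR : dedekind_domain R.
Local Notation K := {fraction R}.
Implicit Types (M : K -> Prop) (I J : nat -> K -> Prop) (P Q : lmodType R).

(** Submodules are predicates on one fixed [P], so that the induction in [embedded_rep] can pass to
    kernels without forming new module types. *)
Definition subP P (S : P -> Prop) :=
  [/\ S 0, forall x y, S x -> S y -> S (x + y) & forall (a : R) x, S x -> S (a *: x)].

(* The image of the last coordinate is an ideal, hence zero or projective, and
   in the latter case it splits off. *)
Lemma embedded_rep P m (S : P -> Prop) (phi : nat -> P -> K) :
  subP S -> (forall i, semilin (phi i)) ->
  (forall i x, (i < m)%N -> S x -> Rset (phi i x)) ->
  (forall x, S x -> (forall i, (i < m)%N -> phi i x = 0) -> x = 0) ->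
  exists r psi I, repS S r psi I.
Proof.
move=> + lphi; elim: m S => [|m IH] S [S0 SD SZ] Rphi inj.
  exists 0%N, phi, (fun _ => @Rset R); split=> //; by [move=> *; exists 0|auto].
have SN x : S x -> S (- x) by rewrite -scaleN1r; apply: SZ.
pose A y := exists2 x, S x & phi m x = y.
have iA : idealK A.
  split; last by move=> y [x Sx <-]; apply: Rphi.
  split; first by exists 0 => //; rewrite semilin0.
    by move=> _ _ [x Sx <-] [y Sy <-]; exists (x + y); rewrite ?semilinD //; apply: SD.
  by move=> a _ [x Sx <-]; exists (a *: x); rewrite ?semilinZ //; apply: SZ.
case: (classic (exists2 a, A a & a != 0)) => [A0|nA0]; last first.
  apply: (IH S) => // [i x im|x Sx H]; first by apply: Rphi; apply: ltnW.
  apply: inj => // i; rewrite ltnS leq_eqVlt => /orP[/eqP ->|/H //].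
  by apply/eqP/negPn/negP => n0; apply: nA0; exists (phi m x) => //; exists x.
have [sA A1] := ideal_invertible dedR iA A0.
have [s [Hs s1]] := fmul_seq sA A1.
have [w Hw] : exists w, forall a, A a -> S (w a) /\ phi m (w a) = a.
  apply: (choice (fun a x => A a -> S x /\ phi m x = a)) => a.
  by case: (classic (A a)) => [[x Sx E]|nA]; [exists x|exists 0].
have [rho Hrho] : exists rho : K -> R, forall x, Rset x -> x = (rho x)%:F.
  apply: (choice (fun x y => Rset x -> x = y%:F)) => x.
  by case: (classic (Rset x)) => [[y E]|nR]; [exists y|exists 0].
(* A section of the last coordinate: [t = sum a_i (b_i t)] has coefficients [b_i t] in [R], and each
   [a_i] is lifted to [w a_i]. *)
pose sec t := \sum_(u <- s) rho (u.2 * t) *: w u.1.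
have Ssec t : S (sec t).
  rewrite /sec big_seq; elim/big_rec: _ => [//|u x us Sx]; apply: SD => //; apply: SZ.
  by case: (Hs u us) => /Hw [].
have psec psi t : semilin psi -> A t ->
    psi (sec t) = \sum_(u <- s) u.2 * t * psi (w u.1).
  move=> lpsi At; rewrite /sec semilin_sum // big_seq [RHS]big_seq.
  apply: eq_bigr => u us; rewrite semilinZ // -Hrho //.
  by case: (Hs u us) => _; apply.
have phisec t : A t -> phi m (sec t) = t.
  move=> At; rewrite psec // -[RHS]mul1r s1 mulr_suml big_seq [RHS]big_seq.
  apply: eq_bigr => u us; case: (Hs u us) => /Hw [_ ->] _; ring.
pose S' x := S x /\ phi m x = 0.
have [|i x im []||r [psi [J [l v mm i1 sj]]]] := IH S'.
- rewrite /S'; split=> [|x y [Sx x0] [Sy y0]|a x [Sx x0]]; first by rewrite semilin0.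
    by rewrite semilinD // x0 y0 addr0; split=> //; apply: SD.
  by rewrite semilinZ // x0 mulr0; split=> //; apply: SZ.
- by move=> Sx _; apply: Rphi => //; apply: ltnW.
- move=> x [Sx x0] H; apply: inj => // i; rewrite ltnS leq_eqVlt => /orP[/eqP ->//|].
  exact: H.
(* On [S] this is [psi i] of the kernel component [x - sec (phi m x)]; the expanded formula is
   semilinear on all of [P], as [repS] demands. *)
pose psi' i x := if (i < r)%N then psi i x - \sum_(u <- s) u.2 * phi m x * psi i (w u.1)
  else phi m x.
have psi'E i x : (i < r)%N -> S x -> psi' i x = psi i (x - sec (phi m x)).
  by move=> ir Sx; rewrite /psi' ir semilinB // psec //; exists x.
have psi'r x : psi' r x = phi m x by rewrite /psi' ltnn.
have S'sec x : S x -> S' (x - sec (phi m x)).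
  move=> Sx; split; first by apply: SD => //; apply: SN.
  by rewrite semilinB // phisec ?subrr //; exists x.
exists r.+1, psi', (fun i => if (i < r)%N then J i else A); split.
- move=> i; rewrite /psi'; case: (i < r)%N => //; split=> [x y|a x].
    rewrite !(semilinD (lphi _)) !(semilinD (l _)) [RHS]addrACA -opprD -big_split /=; congr (_ - _).
    by apply: eq_bigr => u _; ring.
  rewrite !(semilinZ (lphi _)) !(semilinZ (l _)) mulrBr mulr_sumr; congr (_ - _).
  by apply: eq_bigr => u _; ring.
- by move=> i _; case: ifP => [/v //|_]; apply: ideal_invertible.
- move=> i x; rewrite ltnS leq_eqVlt => /orP[/eqP ->|ir] Sx.
    by rewrite ltnn psi'r; exists x.
  by rewrite ir psi'E //; apply: mm => //; apply: S'sec.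
- move=> x Sx H; have x0 : phi m x = 0 by rewrite -psi'r H.
  apply: i1 => // i ir; rewrite -(H i (ltnW ir)) psi'E // x0.
  have A00 : A 0 by exists 0 => //; rewrite semilin0.
  rewrite semilinB // psec // big1 ?subr0 // => u _; ring.
- move=> vv Hv; have [|y [Sy y0] Hy] := sj vv.
    by move=> i ir; have := Hv i (ltnW ir); rewrite ir.
  have At : A (vv r) by have := Hv r (ltnSn r); rewrite ltnn.
  exists (y + sec (vv r)); first exact: SD.
  have E : phi m (y + sec (vv r)) = vv r by rewrite semilinD // y0 add0r phisec.
  move=> i; rewrite ltnS leq_eqVlt => /orP[/eqP ->|ir]; first by rewrite psi'r.
  by rewrite psi'E ?E ?addrK ?Hy //; apply: SD.
Qed.

Lemma projective_rep P : fg_projective P -> exists r psi I, rep (P := P) r psi I.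
Proof.
move=> [m [f [g gK]]]; apply: (embedded_rep (m := m) (phi := fun i x => rVcoord i (g x))).
- by [].
- move=> i; have [lD lZ] := @rVcoord_semilin R m i.
  by split=> *; rewrite ?linearD ?linearZ ?lD ?lZ.
- by move=> i x im _; rewrite -[i]/(val (Ordinal im)) rVcoordE.
- move=> x _ H; rewrite -[x]gK; suff -> : g x = 0 by rewrite linear0.
  by apply/rowP=> j; apply/eqP; rewrite mxE -tofrac_eq0 -rVcoordE H.
Qed.

(* If [al a + be b = 1] with [a] in [A], [b] in [B], [al] in [A^-1] and [be] in
   [B^-1], the matrix [(al, be; b, -a)] maps [A + B] bijectively onto [R + AB]. *)
Lemma rep_merge P r phi I j : rep (P := P) r phi I -> (j.+1 < r)%N ->
  exists phi', rep (P := P) r phi' (fun i => if i == j then @Rset R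
    else if i == j.+1 then fmul (I j) (I j.+1) else I i).
Proof.
move=> [l v m inj s] jr; have jr' := ltnW jr.
have iA := v j jr'; have iB := v j.+1 jr; have [sA _] := iA; have [sB _] := iB.
have [al [be [a [b [Aal Bbe Aa Bb ab]]]]] := invertible_comaximal dedR iA iB.
have nj : (j.+1 == j) = false by rewrite -[X in _ == X]addn0 -addn1 eqn_add2l.
exists (fun i x => if i == j then al * phi j x + be * phi j.+1 x
    else if i == j.+1 then b * phi j x - a * phi j.+1 x else phi i x); split.
- move=> i; case: eqP => _; first by split=> *; rewrite ?semilinD ?semilinZ //; ring.
  by case: eqP => _ //; split=> *; rewrite ?semilinD ?semilinZ //; ring.
- move=> i ir; case: eqP => _; first exact: invertible_Rset.
  by case: eqP => _; [exact: invertible_fmul|exact: v].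
- move=> i x ir _; have Hj := m j x jr' Logic.I; have Hj' := m j.+1 x jr Logic.I.
  case: eqP => _; first by apply: RsetD; [apply: Aal|apply: Bbe].
  case: eqP => _; last exact: m.
  apply: (submodB (submod_fmul _ _)); first by rewrite mulrC; apply: mem_fmul.
  exact: mem_fmul.
- move=> x _ H; apply: inj => // i ir.
  have := H j jr'; rewrite eqxx => E1; have := H j.+1 jr; rewrite nj eqxx => E2.
  case: (i =P j) => [->|/eqP ij].
    rewrite -[LHS]mul1r -ab.
    transitivity (a * (al * phi j x + be * phi j.+1 x) + be * (b * phi j x - a * phi j.+1 x)).
      ring.
    by rewrite E1 E2 !mulr0 addr0.
  case: (i =P j.+1) => [->|/eqP ij'].
    rewrite -[LHS]mul1r -ab.
    transitivity (b * (al * phi j x + be * phi j.+1 x) - al * (b * phi j x - a * phi j.+1 x)).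
      ring.
    by rewrite E1 E2 !mulr0 subr0.
  by have := H i ir; rewrite (negPf ij) (negPf ij').
- move=> vv Hv; have := Hv j jr'; rewrite eqxx => Ru; have := Hv j.+1 jr; rewrite nj eqxx => Aw.
  set u := vv j in Ru; set t := vv j.+1 in Aw.
  have Abe : I j (be * t).
    move: (t) Aw; apply: fmul_sub => [|x y Ax By]; first exact: submod_mull.
    by rewrite mulrCA mulrC; apply: submodR => //; apply: Bbe.
  have Bal : I j.+1 (al * t).
    move: (t) Aw; apply: fmul_sub => [|x y Ax By]; first exact: submod_mull.
    by rewrite mulrA; apply: submodR => //; apply: Aal.
  (* The matrix has determinant [-1], and its inverse is [(a, be; b, -al)]. *)
  have [|x _ Hx] := s (fun i => if i == j then a * u + be * t
      else if i == j.+1 then b * u - al * t else vv i).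
    move=> i ir; case: (i =P j) => [->|/eqP ij].
      by apply: submodD => //; rewrite mulrC; apply: submodR.
    case: (i =P j.+1) => [->|/eqP ij'].
      by apply: submodB => //; rewrite mulrC; apply: submodR.
    by have := Hv i ir; rewrite (negPf ij) (negPf ij').
  exists x => // i ir; rewrite (Hx j) // (Hx j.+1) // nj !eqxx.
  case: (i =P j) => [->|/eqP ij].
    by rewrite -[RHS]mul1r -ab; rewrite /u; ring.
  case: (i =P j.+1) => [->|/eqP ij'].
    by rewrite -[RHS]mul1r -ab; rewrite /t; ring.
  by rewrite Hx // (negPf ij) (negPf ij').
Qed.

(** Each use of [rep_merge] pushes the accumulated product one index to the right and leaves [R]
    behind. At the last index all the classes are gathered in one factor. *)
Lemma rep_steinitz P r phi I j : rep (P := P) r phi I -> (j < r)%N ->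
  exists phi', rep (P := P) r phi' (fun i => if (i < j)%N then @Rset R
    else if i == j then iprod j.+1 I else I i).
Proof.
move=> rP; have [_ v _ _ _] := rP; elim: j => [|j IH] jr.
  exists phi; apply: rep_ext rP => i ir; rewrite ltn0; case: eqP => [->|//].
  by rewrite iprod1 //; case: (v 0%N jr).
have [phi' rP'] := IH (ltnW jr); have [psi rQ] := rep_merge rP' jr.
exists psi; apply: rep_ext rQ => i ir; rewrite !ltnn !eqxx.
rewrite (gtn_eqF (ltnSn j)) [(j.+1 < j)%N]ltnNge leqnSn /= ltnS.
case: (ltngtP i j) => [ij|ij|//]; first by rewrite ltn_eqF // ltnS ltnW.
by case: eqP => // _; rewrite -iprodS.
Qed.

Definition has_type P r (A : K -> Prop) :=
  exists phi I, rep (P := P) r phi I /\ sim (iprod r I) A.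

End Steinitz.

(** * Classification by rank and class *)

Section Types.
Variable R : idomainType.
Hypothesis dedR : dedekind_domain R.
Local Notation K := {fraction R}.
Implicit Types (A B : K -> Prop) (I J : nat -> K -> Prop) (P Q : lmodType R).

Lemma projective_has_type P : fg_projective P ->
  exists r A, invertible A /\ has_type P r A.
Proof.
move=> /(projective_rep dedR) [r [phi [I rP]]]; exists r, (iprod r I); split.
  by apply: invertible_iprod; case: rP.
by exists phi, I.
Qed.

Lemma has_type_uniq P r s A B : has_type P r A -> has_type P s B -> r = s /\ sim A B.
Proof.
move=> [phi [I [rP sA]]] [psi [J [rQ sB]]]; have [rs sIJ] := rep_uniq rP rQ.
by split=> //; apply: sim_trans (sim_sym sA) (sim_trans sIJ sB).
Qed.

Lemma has_type_sim P r A B : has_type P r A -> sim A B -> has_type P r B.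
Proof. by move=> [phi [I [rP sA]]] AB; exists phi, I; split=> //; apply: (sim_trans sA). Qed.

Lemma rep_sim P r phi I j B : rep (P := P) r phi I -> (j < r)%N -> invertible B ->
  sim (I j) B -> exists phi', rep (P := P) r phi' (fun i => if i == j then B else I i).
Proof.
move=> [l v m inj s] jr iB [c [c0 H]].
exists (fun i x => if i == j then c * phi j x else phi i x); split.
- by move=> i; case: eqP => _ //; split=> *; rewrite ?semilinD ?semilinZ //; ring.
- by move=> i ir; case: eqP => // _; apply: v.
- by move=> i x ir _; case: eqP => _; [apply/H; apply: m|apply: m].
- move=> x _ H0; apply: inj => // i ir; have := H0 i ir; case: eqP => // -> /eqP.
  by rewrite mulf_eq0 (negPf c0) => /eqP.
- move=> w Hw; have [|x _ Hx] := s (fun i => if i == j then c^-1 * w j else w i).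
    move=> i ir; have := Hw i ir; case: eqP => // -> Bw.
    by apply/H; rewrite mulVKf.
  exists x => // i ir; case: eqP => [->|/eqP ij]; first by rewrite Hx // eqxx mulVKf.
  by rewrite Hx // (negPf ij).
Qed.

Lemma has_type_iso P Q r A : has_type P r A -> has_type Q r A -> mod_iso P Q.
Proof.
move=> [phi [I [rP sA]]] [psi [J [rQ sB]]].
(* In rank [0] there is no last index to hold the product, and the two families of ideals are both
   empty. *)
case: r => [|r] in rP sA rQ sB *.
  by apply: (rep_mod_iso rP); apply: rep_ext rQ.
have [phi' rP'] := rep_steinitz dedR rP (ltnSn r).
have [psi' rQ'] := rep_steinitz dedR rQ (ltnSn r).
have iJ : invertible (iprod r.+1 J) by apply: invertible_iprod; case: rQ.
have [|phi'' rP''] := rep_sim rP' (ltnSn r) iJ.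
  by rewrite ltnn eqxx; apply: (sim_trans sA); apply: sim_sym.
apply: (rep_mod_iso rP''); apply: rep_ext rQ' => i; rewrite ltnS.
by case: ltngtP.
Qed.

Lemma mod_iso_has_type P Q r A : mod_iso P Q -> has_type P r A -> has_type Q r A.
Proof.
move=> PQ [phi [I [rP sA]]]; have [psi rQ] := mod_iso_rep PQ rP.
by exists psi, I.
Qed.

Lemma has_type_prod P Q r s A B : has_type P r A -> has_type Q s B ->
  has_type (P * Q)%type (r + s) (fmul A B).
Proof.
move=> [phi [I [rP sA]]] [psi [J [rQ sB]]].
eexists; eexists; split; first exact: (rep_prod rP rQ).
by rewrite iprod_cat; apply: sim_fmul.
Qed.

Lemma has_type_rV n : has_type 'rV[R]_n n (@Rset R).
Proof. by eexists; eexists; split; [exact: rep_rV|rewrite iprod_Rset]. Qed.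

Lemma has_type0 P A : has_type P 0 A -> sim A (@Rset R).
Proof. by move=> [phi [I [rP]]]; rewrite iprod0; apply: sim_sym. Qed.

Lemma proj_rank_has_type P k r A : proj_rank P k -> has_type P r A -> k = r.
Proof. by move=> rk [phi [I [rP _]]]; apply: (proj_rank_rep rk rP). Qed.

Lemma invertible_has_type A : invertible A -> exists P : lmodType R,
  [/\ fg_projective P, proj_rank P 1 & has_type P 1 A].
Proof.
move=> iA; have [P [fP [phi rP]]] := invertible_module iA; exists P.
have tP : has_type P 1 A by exists phi, (fun _ => A); rewrite iprod1 //; case: iA.
split=> //; have [m [f [g gK]]] := fP.
have rk : proj_rank P (\rank (map_mx (@tofrac R) (lin1_mx (g \o f)))) by exists m, f, g.
by rewrite -(proj_rank_has_type rk tP).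
Qed.

Lemma fmul_invI A : invertible A -> fmul A (invI A) = @Rset R.
Proof.
move=> [sA A1]; apply: pred_ext => x; split; first exact: fmul_invI_sub.
by apply: submod1_Rset.
Qed.

(** [T P r g] stands for: [P] has rank [r] and class [g]; [c g] is a line of class [g]. The count
    uses only this interface. [cl_rank0] is what forces the class to vanish wherever the rank
    does. *)
Record classification (G : finZmodType) (c : G -> lmodType R)
  (T : lmodType R -> nat -> G -> Prop) : Prop := Classification {
  cl_proj : forall P, fg_projective P -> exists r g, T P r g;
  cl_uniq : forall P r s g h, T P r g -> T P s h -> r = s /\ g = h;
  cl_iso : forall P Q r g, T P r g -> T Q r g -> mod_iso P Q;
  cl_mod_iso : forall P Q r g, mod_iso P Q -> T P r g -> T Q r g;
  cl_prod : forall P Q r s g h, T P r g -> T Q s h -> T (P * Q)%type (r + s)%N (g + h);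
  cl_rV : forall n, T 'rV[R]_n n 0;
  cl_rank0 : forall P g, T P 0%N g -> g = 0;
  cl_rank : forall P k r g, proj_rank P k -> T P r g -> k = r;
  cl_line_proj : forall g, fg_projective (c g);
  cl_line : forall g, T (c g) 1%N g }.

(** Each representative [c i] has an ideal [C i], and every invertible ideal is similar to exactly
    one of them. The product of ideals thus descends to a law on ['I_p], whose axioms are checked up
    to [sim] and transferred by [Cinj]. *)
Lemma pic_classification p : pic_order R p ->
  exists (G : finZmodType) c T, @classification G c T /\ #|G| = p.
Proof.
move=> [c [cP [cinj csurj]]].
have [C HC] : exists C, forall i, invertible (C i) /\ has_type (c i) 1 (C i).
  apply: (choice (fun i A => invertible A /\ has_type (c i) 1 A)) => i.
  have [fP rP] := cP i; have [r [A [iA tA]]] := projective_has_type fP.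
  by exists A; rewrite (proj_rank_has_type rP tA).
have iC i : invertible (C i) by case: (HC i).
have Csurj A : invertible A -> exists i, sim A (C i).
  move=> /invertible_has_type [P [fP rP tP]]; have [i iso] := csurj P (conj fP rP).
  exists i; have [_ tC] := HC i.
  by have [] := has_type_uniq (mod_iso_has_type iso tP) tC.
have Cinj i j : sim (C i) (C j) -> i = j.
  have [[_ ti] [_ tj]] := (HC i, HC j); move=> sC; apply: cinj.
  exact: (has_type_iso (has_type_sim ti sC)).
have [i0 _] := Csurj _ (invertible_Rset R).
(* Predicates that are not invertible ideals get the dummy class [i0]. *)
have [cl Hcl] : exists cl, forall A, invertible A -> sim A (C (cl A)).
  apply: (choice (fun A i => invertible A -> sim A (C i))) => A.
  by case: (classic (invertible A)) => [/Csurj [i]|nA]; [exists i|exists i0].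
pose add i j := cl (fmul (C i) (C j)); pose opp i := cl (invI (C i)).
pose zero := cl (@Rset R).
have addP i j : sim (C (add i j)) (fmul (C i) (C j)).
  by apply: sim_sym; apply: Hcl; apply: invertible_fmul.
have oppP i : sim (C (opp i)) (invI (C i)).
  by apply: sim_sym; apply: Hcl; apply: invertible_invI.
have zeroP : sim (C zero) (@Rset R) by apply/sim_sym/Hcl/invertible_Rset.
have addA : associative add.
  move=> i j k; apply: Cinj; apply: sim_trans (addP _ _) _; apply: sim_sym.
  apply: sim_trans (addP _ _) _; apply: (@sim_trans _ (fmul (fmul (C i) (C j)) (C k))).
    exact: sim_fmul.
  apply: (@sim_trans _ (fmul (C i) (fmul (C j) (C k)))).
    by apply: sim_ext => x; split; [apply: fmulA|apply: fmulAr].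
  by apply: sim_fmul => //; apply: sim_sym.
have addC : commutative add.
  move=> i j; apply: Cinj; apply: sim_trans (addP _ _) _; apply: sim_sym.
  by apply: sim_trans (addP _ _) _; apply: sim_ext => x; split; apply: fmulC.
have add0 : left_id zero add.
  move=> i; apply: Cinj; apply: sim_trans (addP _ _) _.
  apply: (@sim_trans _ (fmul (@Rset R) (C i))); first exact: sim_fmul.
  by apply: sim_ext => x; split; [apply: fmul1; case: (iC i)|apply: fmul1r].
have addN : left_inverse zero opp add.
  move=> i; apply: Cinj; rewrite addC; apply: sim_trans (addP _ _) _.
  apply: (@sim_trans _ (fmul (C i) (invI (C i)))); first exact: sim_fmul.
  by rewrite fmul_invI //; apply: sim_sym.
pose G : finZmodType := HB.pack 'I_p (GRing.isZmodule.Build 'I_p addA addC add0 addN).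
exists G, c, (fun P r g => has_type P r (C g)); split; last exact: card_ord.
split.
- move=> P /projective_has_type [r [A [iA tA]]]; exists r, (cl A).
  by apply: (has_type_sim tA); apply: Hcl.
- by move=> P r s g h tg th; have [? /Cinj] := has_type_uniq tg th.
- by move=> P Q r g; apply: has_type_iso.
- by move=> P Q r g; apply: mod_iso_has_type.
- move=> P Q r s g h tg th; apply: (has_type_sim (has_type_prod tg th)).
  exact: sim_sym (addP g h).
- by move=> n; apply: (has_type_sim (has_type_rV n)); apply: sim_sym.
- move=> P g /has_type0 sg; apply: Cinj; apply: (sim_trans sg); exact: sim_sym.
- by move=> P k r g; apply: proj_rank_has_type.
- by move=> g; case: (cP g).
- by move=> g; case: (HC g).
Qed.
End Types.

(** * Counting solutions *)

Section Counting.
Variables (G : finZmodType) (p : nat).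
Hypotheses (pr_p : prime p) (cardG : #|G| = p).

(** Translation by [x] permutes [G], so the sum of all elements is unchanged when [x] is added [p]
    times. *)
Lemma mulrn_card (x : G) : x *+ p = 0.
Proof.
have: \sum_(g : G) g = \sum_(g : G) (g + x) by rewrite (reindex_inj (addIr x)).
rewrite big_split /= sumr_const cardG => /eqP.
by rewrite -subr_eq0 opprD addNKr oppr_eq0 => /eqP.
Qed.

(** Bezout: with [u j = 1 + v p], the element [g *+ u] works because [p] annihilates [G]. *)
Lemma mulrn_surj j (g : G) : ~~ (p %| j)%N -> exists h : G, h *+ j = g.
Proof.
move=> npj; have j0 : (0 < j)%N by case: j npj => //; rewrite dvdn0.
have /coprimeP : coprime j p by rewrite coprime_sym prime_coprime.
move=> /(_ j0) [[u v] /= uv]; exists (g *+ u).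
have E : (u * j = 1 + v * p)%N.
  by rewrite -uv subnK //; apply: ltnW; rewrite -subn_gt0 uv.
by rewrite -mulrnA E mulrnDr mulr1n mulrnA mulrn_card addr0.
Qed.

Variable n : nat.
Implicit Types (S : {set 'I_n}) (l : {ffun 'I_n -> G}) (mu : G).

Definition supp_in S l := [forall i, (i \notin S) ==> (l i == 0)].
(** Index [i] stands for part size [i.+1], hence the weight. *)
Definition wsum l := \sum_i l i *+ i.+1.
Definition sols S mu := [set l | supp_in S l && (wsum l == mu)].

Lemma card_supp_in S : #|[set l | supp_in S l]| = (p ^ #|S|)%N.
Proof.
rewrite -cardG -(card_pffun_on 0 (mem S) (predT : {pred G})); apply: eq_card => l.
rewrite inE; apply/forallP/pffun_onP => [H|[H _] i].
  split=> [|x _ //]; apply/subsetP => i; rewrite inE; apply: contraR => iS.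
  by have := H i; rewrite iS.
by apply/implyP; apply: contraR => li; move/subsetP: H => /(_ i); rewrite inE; apply.
Qed.

(** Solutions for [mu] are translated by a family concentrated at [i0], where multiplication by
    [i0.+1] reaches [mu' - mu]. Exchanging [mu] and [mu'] gives equality. *)
Lemma card_sols_le S mu mu' i0 : i0 \in S -> ~~ (p %| i0.+1)%N ->
  (#|sols S mu| <= #|sols S mu'|)%N.
Proof.
move=> i0S np; have [h hE] := mulrn_surj (mu' - mu) np.
pose d : {ffun 'I_n -> G} := [ffun i => if i == i0 then h else 0].
rewrite -(card_imset _ (addIr d)); apply/subset_leq_card/subsetP => _ /imsetP[l lS ->].
move: lS; rewrite !inE => /andP[/forallP lS /eqP lmu]; apply/andP; split.
  apply/forallP => i; apply/implyP => iS; rewrite !ffunE.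
  have := lS i; rewrite iS => /eqP ->; rewrite add0r.
  by case: (i =P i0) iS => // ->; rewrite i0S.
rewrite /wsum (eq_bigr (fun i => l i *+ i.+1 + d i *+ i.+1)) => [|i _]; last first.
  by rewrite ffunE mulrnDl.
rewrite big_split /= -/(wsum l) lmu (bigD1 i0) //= big1 => [|i ii0]; last first.
  by rewrite ffunE (negPf ii0) mul0rn.
by rewrite ffunE eqxx hE addr0 addrC subrK.
Qed.

(** If all weights are multiples of [p], every weighted sum is [0]; this includes the empty [S].
    Otherwise the [p] fibres of [wsum] share the [p ^ #|S|] families equally. *)
Lemma card_sols S mu : mu != 0 -> 
  #|sols S mu| = if [forall i in S, (p %| i.+1)%N] then 0%N else (p ^ #|S|.-1)%N.
Proof.
move=> mu0; case: ifP => [/forall_inP dS|/negbT].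
  apply: eq_card0 => l; rewrite !inE; apply/negP => /andP[/forallP lS /eqP lmu].
  case/eqP: mu0; rewrite -lmu; apply: big1 => i _.
  case: (boolP (i \in S)) => [/dS /dvdnP[q ->]|iS]; first by rewrite mulnC mulrnA mulrn_card mul0rn.
  by have := lS i; rewrite iS => /eqP ->; rewrite mul0rn.
rewrite negb_forall_in => /exists_inP[i0 i0S np].
have E nu : #|sols S nu| = #|sols S mu|.
  by apply/eqP; rewrite eqn_leq !(card_sols_le _ _ i0S np).
have := card_supp_in S; rewrite -sum1_card (partition_big wsum predT) //=.
rewrite (eq_bigr (fun _ => #|sols S mu|)) => [|nu _]; last first.
  by rewrite -(E nu) -sum1_card; apply: eq_bigl => l; rewrite !inE.
rewrite sum_nat_const cardT -cardE cardG => /eqP.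
have S0 : (0 < #|S|)%N by apply/card_gt0P; exists i0.
by rewrite -[in (p ^ _)%N](prednK S0) expnS eqn_pmul2l ?prime_gt0 // => /eqP.
Qed.

Definition msupp (m : {ffun 'I_n -> 'I_n.+1}) := [set i | m i != 0%N :> nat].

(** A pair codes the ranks and classes of a tuple of modules up to isomorphism. *)
Definition typeset mu := [set ml : {ffun 'I_n -> 'I_n.+1} * {ffun 'I_n -> G} |
  is_partition ml.1 && (ml.2 \in sols (msupp ml.1) mu)].

(** The truncated subtraction is exact, as [nu_p] counts a subset of what [nu] counts. *)
Lemma nu'E k : nu' n k p = #|[set m : {ffun 'I_n -> 'I_n.+1} |
  [&& is_partition m, #|msupp m| == k & ~~ [forall i in msupp m, (p %| i.+1)%N]]]|.
Proof.
have sE (m : {ffun 'I_n -> 'I_n.+1}) : #|[pred i : 'I_n | (m i != 0%N :> nat)]| = #|msupp m|.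
  by apply: eq_card => i; rewrite !inE.
have dE (m : {ffun 'I_n -> 'I_n.+1}) :
    [forall i : 'I_n, (m i != 0%N :> nat) ==> (p %| i.+1)%N] =
    [forall i in msupp m, (p %| i.+1)%N].
  by apply: eq_forallb => i; rewrite !inE.
rewrite /nu' /nu /nu_p; set A := [pred m | _ && _]; set B := [pred m | _].
rewrite -(cardID B A).
have -> : #|[predI A & B]| = #|B|.
  by apply: eq_card => m; rewrite !inE; case: is_partition => //=; case: eqP => //=.
rewrite addKn; apply: eq_card => m; rewrite !inE sE dE.
by case: is_partition => //=; case: eqP => //=; rewrite ?andbT.
Qed.

Lemma card_typeset mu : mu != 0 -> (0 < n)%N ->
  #|typeset mu| = (\sum_(1 <= k < n.+1) nu' n k p * p ^ k.-1)%N.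
Proof.
move=> mu0 n0; rewrite -sum1_card.
rewrite (eq_bigl (fun ml : {ffun 'I_n -> 'I_n.+1} * {ffun 'I_n -> G} =>
  is_partition ml.1 && (ml.2 \in sols (msupp ml.1) mu))) => [|ml]; last by rewrite inE.
rewrite -(pair_big_dep (fun m : {ffun 'I_n -> 'I_n.+1} => is_partition m)
  (fun m (l : {ffun 'I_n -> G}) => l \in sols (msupp m) mu) (fun _ _ => 1%N)) /=.
pose div m := [forall i in msupp m, (p %| i.+1)%N].
rewrite (eq_bigr (fun m => if ~~ div m then (p ^ #|msupp m|.-1)%N else 0%N)) => [|m _]; last first.
  by rewrite sum1_card card_sols // if_neg.
rewrite -big_mkcondr big_add1 /= big_mkord.
have ms0 m : is_partition m -> (0 < #|msupp m|)%N.
  move=> /eqP E; rewrite lt0n; apply/eqP => /cards0_eq m0.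
  move: n0; rewrite -E big1 // => i _; have : i \notin msupp m by rewrite m0 inE.
  by rewrite inE negbK => /eqP ->; rewrite muln0.
(* Partitions are grouped by [#|msupp m|.-1] in ['I_n], which matches the summation index shifted
   down by one; [ms0] ensures that the predecessor loses nothing. *)
have msn m : (#|msupp m|.-1 < n)%N.
  case: #|msupp m| (max_card (mem (msupp m))) => //= k; rewrite card_ord //.
rewrite (partition_big (fun m => Ordinal (msn m)) predT) //=; apply: eq_bigr => k _.
rewrite nu'E -sum1_card big_distrl /=; apply: eq_big => m.
  rewrite inE -andbA -val_eqE /=; case: (boolP (is_partition m)) => //= /ms0.
  by case: #|msupp m| => //= j _; rewrite andbC eqSS.
by move=> /andP[_ /eqP <-]; rewrite mul1n.
Qed.
End Counting.

(** * Feedback classes *)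

Section Classes.
Variables (R : idomainType) (G : finZmodType) (c : G -> lmodType R).
Variable T : lmodType R -> nat -> G -> Prop.
Hypothesis clT : classification c T.

(** For [m = 0] the class [g] is discarded, whence the side condition of [stdmod_type]; the support
    condition in [typeset] provides it. *)
Definition stdmod m g : lmodType R :=
  if m is m'.+1 then ('rV[R]_m' * c g)%type else 'rV[R]_0.

Lemma stdmod_projective m g : fg_projective (stdmod m g).
Proof.
case: m => [|m]; first exact: fg_projective_rV.
by apply: fg_projective_prod; [exact: fg_projective_rV|exact: (cl_line_proj clT)].
Qed.

Lemma stdmod_type m g : (m = 0%N -> g = 0) -> T (stdmod m g) m g.
Proof.
case: m => [/(_ erefl) ->|m _]; first exact: (cl_rV clT).
by have := cl_prod clT (cl_rV clT m) (cl_line clT g); rewrite addn1 add0r.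
Qed.

Lemma dpow_type Z r g k : T Z r g -> T (dpow Z k) (k * r) (g *+ k).
Proof.
move=> TZ; elim: k => [|k IH]; first by rewrite mul0n mulr0n; apply: (cl_rV clT).
by rewrite mulSn addnC mulrSr; apply: (cl_prod clT).
Qed.

Lemma dsum_type (z : nat -> lmodType R) (r : nat -> nat) (g : nat -> G) k :
  (forall i, (i < k)%N -> T (z i) (r i) (g i)) ->
  T (dsum_tuple z k) (\sum_(i < k) i.+1 * r i)%N (\sum_(i < k) g i *+ i.+1).
Proof.
elim: k => [|k IH] Tz; first by rewrite !big_ord0; apply: (cl_rV clT).
rewrite !big_ord_recr /=; apply: (cl_prod clT); last exact: (dpow_type k.+1 (Tz k (ltnSn k))).
by apply: IH => i ik; apply: Tz; apply: ltnW.
Qed.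

Definition tuple_of n (ml : {ffun 'I_n -> 'I_n.+1} * {ffun 'I_n -> G}) (i : nat) :
    lmodType R :=
  if insub i is Some j then stdmod (ml.1 j) (ml.2 j) else 'rV[R]_0.

Lemma tuple_ofE n (ml : {ffun 'I_n -> 'I_n.+1} * {ffun 'I_n -> G}) (i : 'I_n) :
  tuple_of ml i = stdmod (ml.1 i) (ml.2 i).
Proof. by rewrite /tuple_of valK. Qed.

(** The standard modules realize each coded pair. Uniqueness of types separates distinct codes, and
    reading off the types of an arbitrary tuple gives a code whose standard tuple is isomorphic to
    it entrywise. *)
Lemma fe_typeset X n mu : T X n mu -> fe_is X n #|typeset n mu|.
Proof.
move=> TX; pose D := typeset n mu.
have stdT (ml : {ffun 'I_n -> 'I_n.+1} * {ffun 'I_n -> G}) (i : 'I_n) : ml \in D ->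
    T (tuple_of ml i) (ml.1 i) (ml.2 i).
  rewrite !inE tuple_ofE => /and3P[_ /forallP lS _]; apply: stdmod_type => m0.
  by have := lS i; rewrite inE m0 => /eqP.
exists (fun k => tuple_of (enum_val k)); split=> [k|].
  have Dk : enum_val k \in D by apply: enum_valP.
  move: (enum_val k) Dk => [m l] Dk; split=> [i ik|].
    by rewrite -[i]/(val (Ordinal ik)) tuple_ofE; apply: stdmod_projective.
  apply: (cl_iso clT TX).
  pose r i := if insub i is Some j then m j : nat else 0%N.
  pose g i := if insub i is Some j then l j else 0.
  have rE (i : 'I_n) : r i = m i by rewrite /r valK.
  have gE (i : 'I_n) : g i = l i by rewrite /g valK.
  have := @dsum_type (tuple_of (m, l)) r g n.
  rewrite (eq_bigr (fun i : 'I_n => (i.+1 * m i)%N)) => [|i _]; last by rewrite rE.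
  rewrite (eq_bigr (fun i : 'I_n => l i *+ i.+1)) => [|i _]; last by rewrite gE.
  move: (Dk); rewrite !inE /= => /and3P[/eqP -> _ /eqP lmu]; rewrite -/(wsum l) lmu; apply=> i ik.
  by rewrite -[i]/(val (Ordinal ik)) rE gE; apply: (stdT (m, l)).
split=> [j k iso|z [zP iso]].
  apply: enum_val_inj; have [Dj Dk] := (enum_valP j, enum_valP k).
  have E i : (enum_val j).1 i = (enum_val k).1 i /\ (enum_val j).2 i = (enum_val k).2 i.
    have := cl_mod_iso clT (iso i (ltn_ord i)) (stdT _ i Dj).
    by move=> /(cl_uniq clT)/(_ (stdT _ i Dk)) [/val_inj].
  rewrite [LHS]surjective_pairing [RHS]surjective_pairing.
  by congr (_, _); apply/ffunP => i; case: (E i).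
have [rg Hrg] : exists rg : 'I_n -> nat * G, forall i : 'I_n, T (z i) (rg i).1 (rg i).2.
  apply: (choice (fun (i : 'I_n) u => T (z i) u.1 u.2)) => i.
  by have [r [g Tz]] := cl_proj clT (zP i (ltn_ord i)); exists (r, g).
pose r i := if insub i is Some j then (rg j).1 else 0%N.
pose g i := if insub i is Some j then (rg j).2 else 0.
have rE (i : 'I_n) : r i = (rg i).1 by rewrite /r valK.
have gE (i : 'I_n) : g i = (rg i).2 by rewrite /g valK.
have /(@dsum_type z r g n) Tsum : forall i, (i < n)%N -> T (z i) (r i) (g i).
  move=> i ik; rewrite -[i]/(val (Ordinal ik)) rE gE; exact: Hrg.
have [En Emu] := cl_uniq clT (cl_mod_iso clT iso TX) Tsum.
(* Ranks fit in ['I_n.+1] because [r i] is at most [i.+1 * r i], one term of a sum equal to [n]. *)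
have rn (i : 'I_n) : (r i < n.+1)%N.
  rewrite ltnS [X in (_ <= X)%N]En (bigD1 i) //=.
  by apply: leq_trans (leq_addr _ _); rewrite mulSn leq_addr.
pose ml := ([ffun i : 'I_n => Ordinal (rn i)], [ffun i : 'I_n => g i]).
have Dml : ml \in D.
  rewrite !inE; apply/and3P; split.
  - apply/eqP; rewrite [RHS]En; apply: eq_bigr => i _; by rewrite ffunE.
  - apply/forallP => i; rewrite inE negbK !ffunE /= rE gE; apply/implyP => /eqP r0.
    by have := Hrg i; rewrite r0 => /(cl_rank0 clT) ->.
  - by rewrite [X in _ == X]Emu; apply/eqP; apply: eq_bigr => i _; rewrite ffunE.
exists (enum_rank_in Dml ml) => i ik; rewrite enum_rankK_in //.
have := stdT ml (Ordinal ik) Dml; rewrite !ffunE /= => Tt; apply: (cl_iso clT _ Tt).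
have := Hrg (Ordinal ik); by rewrite -rE -gE.
Qed.
End Classes.

Theorem mainTheorem9 (R : idomainType) (p : nat) :
  dedekind_domain R -> prime p -> pic_order R p ->
  forall (n : nat), (1 <= n)%N ->
  forall (L : lmodType R),
    fg_projective L -> proj_rank L 1 -> ~ mod_iso L 'rV[R]_1 ->
    fe_is ('rV[R]_n.-1 * L)%type n
      (\sum_(1 <= k < n.+1) nu' n k p * p ^ k.-1)%N.
Proof.
move=> dedR pr_p /(pic_classification dedR) [G [c [T [clT cardG]]]] n n0 L fL rL nL.
have [r [mu TL]] := cl_proj clT fL.
have r1 := cl_rank clT rL TL; subst r.
(* With class [0], [L] would have the same type as ['rV[R]_1] and so be free. *)
have mu0 : mu != 0.
  by apply/eqP => mu0; apply: nL; apply: (cl_iso clT TL); rewrite mu0; apply: (cl_rV clT).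
rewrite -(card_typeset pr_p cardG mu0 n0); apply: (fe_typeset clT).
by have := cl_prod clT (cl_rV clT n.-1) TL; rewrite addn1 prednK // add0r.
Qed.
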